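(* Let $a>0$ and let $(\mathrm{w}^a_t)_{t\ge0}$ be the process $(\mathrm{w}_t)_{t\ge0}$ (defined in the context) started from the symmetric Bernoulli measure $\mathrm{w}^a_0=\mathrm{d}_a=\frac12(\delta_{-a}+\delta_a)$. Then its $R$-transform and $S$-transform are given, for $t\ge0$, by $$R_{\mathrm{w}^a_t}(z)=\frac12\Big[2tz^2-1+\sqrt{1+4a^2z^2}\Big],$$ $$S_{\mathrm{w}^a_t}(z)=\frac{1}{(tz)^{1/2}}\left[1+\frac{1}{2z}+\frac{a^2}{2tz}-\frac{1}{2z}\Big(1+\frac{a^2}{t}\Big)\sqrt{1+\frac{4a^2/t}{(1+a^2/t)^2}\,z}\;\right]^{1/2}.$$
   Context: $\mathcal{P}^0(\mathbb{R})$ is the set of Borel probability measures on $\mathbb{R}$ with bounded support, with the weak topology. The Cauchy transform is $G_\mu(z)=\int\frac{\mu(dx)}{z-x}$. The process $(\mathrm{w}_t)_{t\ge0}$ is a continuous $\mathcal{P}^0(\mathbb{R})$-valued process whose Cauchy transforms solve, for $t\ge0$ and $z\in\mathbb{C}^+=\{\operatorname{Im}z>0\}$, $$\frac{\partial G_{\mathrm{w}_t}(z)}{\partial t}+G_{\mathrm{w}_t}(z)\frac{\partial G_{\mathrm{w}_t}(z)}{\partial z}=0$$ with initial datum $G_{\mathrm{w}_0}$; here $G_{\mathrm{d}_a}(z)=z/(z^2-a^2)$. The $R$-transform is $R_\mu(z)=zG_\mu^{\langle-1\rangle}(z)-1$, where $G_\mu^{\langle-1\rangle}$ is the compositional inverse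 of $G_\mu$ (defined near $z=0$, inverting $G_\mu$ near $\infty$). $S$-transform: let $\Psi_\mu(z)=\int\frac{xz}{1-xz}\mu(dx)$. For symmetric $\mu$ of bounded support with $\mu(\{0\})<1$, $\Psi_\mu$ has a unique inverse $\chi_\mu:\Psi_\mu(H)\to H$ on $H=\{\operatorname{Im}z<0,\ |\operatorname{Re}z|<|\operatorname{Im}z|\}$ and a unique inverse $\widetilde\chi_\mu$ on $\widetilde H=\{\operatorname{Im}z>0,\ |\operatorname{Re}z|<|\operatorname{Im}z|\}$, giving two $S$-transforms $\frac{1+z}{z}\chi_\mu(z)$ and $\frac{1+z}{z}\widetilde\chi_\mu(z)$. Formulas are identities of analytic functions near $z=0$ (on the domain of the $S$-transform for the second one). The inner square roots are the branches equal to $1$ at $z=0$, and the bracket $[\cdots]^{1/2}$ is the branch positive in the limit $z\to0$; the two choices of branch of $(tz)^{1/2}$ correspond to the two $S$-transforms. At $t=0$ the $S$-transform formula is understood as the limit $t\downarrow0$ (which gives $S_{\mathrm{d}_a}(z)=\frac1a\sqrt{\frac{1+z}{z}}$). *)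

(* Defs.v *)
From HB Require Import structures.
From mathcomp Require Import all_boot all_order all_algebra.
From mathcomp Require Import all_classical all_reals all_analysis.
From mathcomp Require Import complex.
Set Implicit Arguments.
Unset Strict Implicit.
Unset Printing Implicit Defensive.
Import Order.TTheory GRing.Theory Num.Theory.
Import numFieldNormedType.Exports.
Local Open Scope classical_set_scope.
Local Open Scope ring_scope.

(* R[i] seen as a numFieldType, so that it carries the topology, the norm and
   the (complex) derivatives of MathComp-Analysis. *)
Definition Cplx (R : realType) : numFieldType := R[i].

Definition toC (R : realType) (x : R) : Cplx R := (x%:C)%C.
Definition ReC (R : realType) (z : Cplx R) : R := complex.Re z.
Definition ImC (R : realType) (z : Cplx R) : R := complex.Im z.

Section transforms.
Context {R : realType}.
Local Notation C := (Cplx R).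
Implicit Types (mu : probability (measurableTypeR R) R) (z : C).

Definition Cintegral mu (f : R -> C) : C :=
  (Rintegral mu setT (fun x => ReC (f x))
    +i* Rintegral mu setT (fun x => ImC (f x)))%C.

Definition bounded_support mu : Prop :=
  exists M : R, mu [set x | M < `|x|] = 0%E.

Definition upper_half_plane : set C := [set z | 0 < ImC z].

Definition cauchy_transform mu : C -> C :=
  fun z => Cintegral mu (fun x => (z - toC x)^-1).

(* K is the compositional inverse, defined near 0, of the restriction of G to a
   neighbourhood of infinity; the value of K at 0 is irrelevant. *)
Definition inverse_near_infinity (G K : C -> C) : Prop :=
  (exists M : R, forall z, M < ReC `|z| -> K (G z) = z) /\
  (\forall z \near (0 : C)^', G (K z) = z).

Definition cauchy_inverse mu : C -> C :=
  xget (fun=> 0) [set K | inverse_near_infinity (cauchy_transform mu) K].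

(* Meaningful for z close to, and different from, 0. *)
Definition R_transform mu : C -> C := fun z => z * cauchy_inverse mu z - 1.

Definition Psi mu : C -> C :=
  fun z => Cintegral mu (fun x => toC x * z / (1 - toC x * z)).

Definition lower_cone : set C := [set z | ImC z < 0 /\ `|ReC z| < `|ImC z|].
Definition upper_cone : set C := [set z | 0 < ImC z /\ `|ReC z| < `|ImC z|].

(* The S-transform attached to the inverse of Psi on H, where H is one of the
   two cones above; its domain is Psi mu @` H. *)
Definition S_transform mu (H : set C) : C -> C :=
  fun z => (1 + z) / z * 'pinv_(fun=> 0) H (Psi mu) z.

Definition sym_bernoulli (a : R) (A : set R) : \bar R :=
  ((2^-1)%:E * \d_(- a)%R A + (2^-1)%:E * \d_a A)%E.

Definition weakly_continuous (w : R -> probability (measurableTypeR R) R) :=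
  forall f : R -> R, continuous f -> (exists M : R, forall x, `|f x| <= M) ->
    {within [set t : R | 0 <= t], continuous (fun t => Rintegral (w t) setT f)}.

(* The time derivative is one-sided at t = 0. *)
Definition solves_burgers (w : R -> probability (measurableTypeR R) R) :=
  forall (t : R) z, 0 <= t -> upper_half_plane z ->
    (toC h)^-1 * (cauchy_transform (w (t + h)) z - cauchy_transform (w t) z)
      @[h --> within [set h : R | 0 <= t + h] (0 : R)^']
    --> - (cauchy_transform (w t) z * derive1 (cauchy_transform (w t)) z).

Definition free_process (w : R -> probability (measurableTypeR R) R) :=
  [/\ forall t, 0 <= t -> bounded_support (w t),
      weakly_continuous w & solves_burgers w].

(* Union over t >= 0 of the domains of the two S-transforms of w t. For w
   started from sym_bernoulli a it equals the domain at t = 0, the disc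
   |z + 1/2| < 1/2. Taking the branches of the square roots on this common
   domain gives a meaning to the limit t -> 0 at a fixed z. *)
Definition S_domain (w : R -> probability (measurableTypeR R) R) : set C :=
  \bigcup_(t in [set t : R | 0 <= t])
     (Psi (w t) @` lower_cone `|` Psi (w t) @` upper_cone).

Definition sqrt_branch (D : set C) (f g : C -> C) : Prop :=
  forall z, D z -> derivable g z 1 /\ g z ^+ 2 = f z.

End transforms.

(* Main.v *)
Require Import Defs.
From HB Require Import structures.
From mathcomp Require Import all_boot all_order all_algebra.
From mathcomp Require Import all_classical all_reals all_analysis.
From mathcomp Require Import measurable_realfun complex ring lra.
Set Implicit Arguments.
Unset Strict Implicit.
Unset Printing Implicit Defensive.
Import Order.TTheory GRing.Theory Num.Theory.
Import numFieldNormedType.Exports.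
Local Open Scope classical_set_scope.
Local Open Scope ring_scope.

(** Fix [t] and [z] in the upper half-plane and put [u := G_t(z)].  Along the
    backward characteristic [s |-> z - (t - s) u], which stays in the upper
    half-plane because [Im u < 0], the function [D(s) := G_s(z - (t - s) u) - u]
    satisfies [D' = - G_s' D] and [D(t) = 0]; Gronwall gives [D(0) = 0], i.e.
    [G_0(z - t u) = u].  With [o := z - t u] this reads [z = o + t G_0(o)],
    [G_t(z) = G_0(o)], and [o] is determined by [z] (Cauchy-Schwarz).

    R-transform: near infinity, also across the real axis by continuity,
    [G_t(o + t G_0(o)) = G_0(o)], so the inverse of [G_t] is that of [G_0] plus [t z].

    S-transform: put [p := 1/z], [y := Psi(z) = p u - 1] and [c := 1/(o^2 - a^2)].
    Then [1 + y = (1 + a^2 c)(1 + t c)] and [u^2 = c (1 + a^2 c)], so [c] solves a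
    quadratic equation with coefficients affine in [y], and [S = u / y].  The signs
    of the square roots are settled because [G_t] is odd: [u] then lies in the lower
    cone, [y] in the disc [|y + 1/2| < 1/2], and all radicands in half-planes. *)

(** * Complex numbers in coordinates *)

(** The Burgers equation is given only pointwise: one time derivative for each fixed [z], one-sided
    at [t = 0], with no joint regularity in [(t, z)]. Differentiating along a moving point therefore
    rests on a Taylor bound for Cauchy transforms whose constant depends only on the distance to the
    real axis, not on the measure, and on weak continuity for the space derivative. The
    characteristic is drawn with the constant velocity [u] read off at its end point, so no
    differential equation has to be solved for it; with this choice [- G_s G_s' + u G_s'] factors as
    [- G_s' (G_s - u)]. For [t > 0] the law [w t] is reached only through subordination, so even its
    symmetry has to be recovered from the oddness of [G_0]. Each square root below is, up to a
    constant factor, the principal root of an expression with positive real part. Two roots are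
    identified by comparing squares and checking that a real part is positive; this is why so many
    lemmas place a quantity in a half-plane or in a cone. The S-transform formula is proved at an
    arbitrary preimage of [y] in the cone, and the partial inverse returns one of these. *)

Section complex_coordinates.
Variable R : realType.
Local Notation C := (Cplx R).
Implicit Types (z w : C) (x y : R).

Definition mkC x y : C := (x +i* y)%C.

Lemma CplxP z w : ReC z = ReC w -> ImC z = ImC w -> z = w.
Proof. by case: z w => [a b] [c d] /= -> ->. Qed.

Lemma ReCD z w : ReC (z + w) = ReC z + ReC w. Proof. by case: z w => ? ? []. Qed.
Lemma ImCD z w : ImC (z + w) = ImC z + ImC w. Proof. by case: z w => ? ? []. Qed.
Lemma ReCN z : ReC (- z) = - ReC z. Proof. by case: z. Qed.
Lemma ImCN z : ImC (- z) = - ImC z. Proof. by case: z. Qed.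
Lemma ReCM z w : ReC (z * w) = ReC z * ReC w - ImC z * ImC w.
Proof. by case: z w => ? ? []. Qed.
Lemma ImCM z w : ImC (z * w) = ReC z * ImC w + ImC z * ReC w.
Proof. by case: z w => ? ? []. Qed.
Lemma ReCV z : ReC z^-1 = ReC z / (ReC z ^+ 2 + ImC z ^+ 2).
Proof. by case: z. Qed.
Lemma ImCV z : ImC z^-1 = - (ImC z / (ReC z ^+ 2 + ImC z ^+ 2)).
Proof. by case: z. Qed.
Lemma ReC_toC x : ReC (toC x) = x. Proof. by []. Qed.
Lemma ImC_toC x : ImC (toC x) = 0. Proof. by []. Qed.
Lemma ReC_mk x y : ReC (mkC x y) = x. Proof. by []. Qed.
Lemma ImC_mk x y : ImC (mkC x y) = y. Proof. by []. Qed.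
Lemma ReC0 : ReC (0 : C) = 0. Proof. by []. Qed.
Lemma ImC0 : ImC (0 : C) = 0. Proof. by []. Qed.
Lemma ReC1 : ReC (1 : C) = 1. Proof. by []. Qed.
Lemma ImC1 : ImC (1 : C) = 0. Proof. by []. Qed.

(** [expr2] is included so that a single rewrite turns a polynomial identity over [C] into sums of
    products of coordinates. The rules for inverses stay outside, because they create
    denominators. *)
Definition CE := (ReCD, ImCD, ReCN, ImCN, ReCM, ImCM, ReC_toC, ImC_toC,
  ReC_mk, ImC_mk, ReC0, ImC0, ReC1, ImC1, expr2).

Lemma toCD x y : toC (x + y) = toC x + toC y.
Proof. by apply: CplxP; rewrite !CE ?addr0. Qed.
Lemma toCN x : toC (- x) = - toC x.
Proof. by apply: CplxP; rewrite !CE ?oppr0. Qed.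
Lemma toCM x y : toC (x * y) = toC x * toC y.
Proof. by apply: CplxP; rewrite !CE; ring. Qed.
Lemma toC0 : toC 0 = 0 :> C. Proof. by []. Qed.
Lemma toC1 : toC 1 = 1 :> C. Proof. by []. Qed.
Lemma toCX x n : toC (x ^+ n) = toC x ^+ n.
Proof. by elim: n => // n IH; rewrite !exprS toCM IH. Qed.
Lemma toCV x : toC x^-1 = (toC x)^-1.
Proof.
apply: CplxP; rewrite ?ReCV ?ImCV !CE !mulr0 ?addr0 ?mul0r ?oppr0 //.
by have [->|x0] := eqVneq x 0; [rewrite invr0 mul0r | field].
Qed.
Lemma toC_eq0 x : (toC x == 0) = (x == 0).
Proof. by apply/eqP/eqP => [/(congr1 (@ReC R))|->]. Qed.
Lemma natC n : n%:R = toC n%:R :> C.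
Proof. by elim: n => // n IH; rewrite -!natr1 toCD IH. Qed.

Lemma neq0_Im z : ImC z != 0 -> z != 0.
Proof. by apply: contraNneq => ->. Qed.
Lemma neq0_Re z : ReC z != 0 -> z != 0.
Proof. by apply: contraNneq => ->. Qed.

(** The norm of [Cplx R] takes values in [Cplx R] itself; [sqn] and [nrm] are its real-valued
    counterparts, on which [lra] and [nra] can work. *)
Definition sqn z : R := ReC z ^+ 2 + ImC z ^+ 2.
Definition nrm z : R := Num.sqrt (sqn z).

Lemma normCE z : `|z| = toC (nrm z).
Proof. exact: normc_def. Qed.
Lemma nrm_norm z : ReC `|z| = nrm z. Proof. by rewrite normCE. Qed.
Lemma nrmD z w : nrm (z + w) <= nrm z + nrm w.
Proof.
have := ler_normD z w; rewrite !normCE -toCD.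
by rewrite /toC lecR.
Qed.
Lemma nrmM z w : nrm (z * w) = nrm z * nrm w.
Proof. by have /(congr1 (@ReC R)) := normrM z w; rewrite !normCE -toCM. Qed.
Lemma nrmV z : nrm z^-1 = (nrm z)^-1.
Proof. by have /(congr1 (@ReC R)) := normfV z; rewrite !normCE -toCV. Qed.
Lemma nrmN z : nrm (- z) = nrm z.
Proof. by have /(congr1 (@ReC R)) := normrN z; rewrite !normCE. Qed.
Lemma nrm_toC x : nrm (toC x) = `|x|.
Proof. by rewrite /nrm /sqn !CE mulr0 addr0 -expr2 sqrtr_sqr. Qed.
Lemma nrm_ge0 z : 0 <= nrm z. Proof. exact: sqrtr_ge0. Qed.
Lemma sqn_ge0 z : 0 <= sqn z. Proof. by rewrite addr_ge0 ?sqr_ge0. Qed.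
Lemma nrm_sq z : nrm z ^+ 2 = sqn z.
Proof. by rewrite sqr_sqrtr ?sqn_ge0. Qed.
Lemma nrm_eq0 z : (nrm z == 0) = (z == 0).
Proof. by rewrite -toC_eq0 -normCE normr_eq0. Qed.
Lemma nrm_gt0 z : (0 < nrm z) = (z != 0).
Proof. by rewrite lt_def nrm_ge0 andbT nrm_eq0. Qed.
Lemma sqn_gt0 z : z != 0 -> 0 < sqn z.
Proof. by rewrite -nrm_sq -nrm_gt0 => ?; rewrite exprn_gt0. Qed.
Lemma nrm_Re z : `|ReC z| <= nrm z.
Proof. by rewrite -sqrtr_sqr ler_sqrt ?sqn_ge0 // lerDl sqr_ge0. Qed.
Lemma nrm_Im z : `|ImC z| <= nrm z.
Proof. by rewrite -sqrtr_sqr ler_sqrt ?sqn_ge0 // lerDr sqr_ge0. Qed.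
Lemma nrm_le z : nrm z <= `|ReC z| + `|ImC z|.
Proof.
have -> : z = toC (ReC z) + toC (ImC z) * mkC 0 1 by apply: CplxP; rewrite !CE; ring.
rewrite (le_trans (nrmD _ _)) // nrmM !nrm_toC !CE !mulr0 !mulr1 !add0r subr0 addr0.
by rewrite /nrm /sqn !CE mulr0 mulr1 add0r sqrtr1 mulr1.
Qed.

Lemma ltC_toC x y : (toC x < toC y :> C) = (x < y). Proof. exact: ltcR. Qed.
(** The order of [R[i]] compares only numbers with equal imaginary parts, so the positive radii of
    the complex topology are real. *)
Lemma posC (e : C) : 0 < e -> e = toC (ReC e) /\ 0 < ReC e.
Proof.
case: e => a b; rewrite ltcE /= => /andP[/eqP b0 a0].
by split => //; apply: CplxP; rewrite ?ImC_toC.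
Qed.

Lemma nrm_triangle z w : nrm z - nrm w <= nrm (z - w).
Proof. by rewrite lerBlDr; have := nrmD (z - w) w; rewrite subrK. Qed.

Definition cj (z : C) : C := mkC (ReC z) (- ImC z).
Lemma nrm_cj z : nrm (cj z) = nrm z.
Proof. by rewrite /nrm /sqn !CE mulrNN. Qed.

Lemma cjD z w : cj (z + w) = cj z + cj w.
Proof. by apply: CplxP; rewrite /cj !CE ?opprD. Qed.
Lemma cjN z : cj (- z) = - cj z.
Proof. by apply: CplxP; rewrite /cj !CE. Qed.
Lemma cjM z w : cj (z * w) = cj z * cj w.
Proof. by apply: CplxP; rewrite /cj !CE; ring. Qed.
Lemma cjV z : cj z^-1 = (cj z)^-1.
Proof.
by apply: CplxP; rewrite /cj ?(ReCV, ImCV) /= ?(ReCV, ImCV) sqrrN //= mulNr.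
Qed.
Lemma cjK z : cj (cj z) = z.
Proof. by apply: CplxP; rewrite /cj !CE ?opprK. Qed.
Lemma cj_toC (x : R) : cj (toC x) = toC x.
Proof. by apply: CplxP; rewrite /cj !CE ?oppr0. Qed.

Section limits.
Context {T : Type} {F : set_system T} {FF : Filter F}.
Implicit Types f : T -> C.

Lemma cvgC_nrm f (l : C) :
  (forall e, 0 < e -> \forall x \near F, nrm (l - f x) < e) -> f @ F --> l.
Proof.
move=> H; apply/cvgrPdist_lt => e /posC[-> e0].
by apply: filterS (H _ e0) => x; rewrite normCE ltC_toC.
Qed.

Lemma cvgC_nrmP f (l : C) : f @ F --> l ->
  forall e, 0 < e -> \forall x \near F, nrm (l - f x) < e.
Proof.
move=> /cvgrPdist_lt H e e0; have := H (toC e); rewrite -toC0 ltC_toC => /(_ e0).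
by apply: filterS => x; rewrite normCE ltC_toC.
Qed.

Lemma cvg_ReC f (l : C) : f @ F --> l -> ReC (f x) @[x --> F] --> ReC l.
Proof.
move=> /cvgC_nrmP H; apply/cvgrPdist_lt => e /H; apply: filterS => x.
by apply: le_lt_trans; rewrite -ReCN -ReCD nrm_Re.
Qed.
Lemma cvg_ImC f (l : C) : f @ F --> l -> ImC (f x) @[x --> F] --> ImC l.
Proof.
move=> /cvgC_nrmP H; apply/cvgrPdist_lt => e /H; apply: filterS => x.
by apply: le_lt_trans; rewrite -ImCN -ImCD nrm_Im.
Qed.
Lemma cvg_ReIm f (l : C) : ReC (f x) @[x --> F] --> ReC l ->
  ImC (f x) @[x --> F] --> ImC l -> f @ F --> l.
Proof.
move=> /cvgrPdist_lt H1 /cvgrPdist_lt H2; apply: cvgC_nrm => e e0.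
have e2 : 0 < e / 2 by rewrite divr_gt0.
apply: filterS2 (H1 _ e2) (H2 _ e2) => x h1 h2.
apply: le_lt_trans (nrm_le _) _; rewrite !CE [e]splitr; exact: ltrD.
Qed.
Lemma cvg_toC (f : T -> R) (l : R) : f @ F --> l -> toC (f x) @[x --> F] --> toC l.
Proof. by move=> fl; apply: cvg_ReIm => //; exact: cvg_cst. Qed.

End limits.

Lemma continuous_toC : continuous (@toC R).
Proof. by move=> x; apply: cvg_toC. Qed.

End complex_coordinates.

(** * Integrals of complex functions *)

Section real_integrals.
Variables (R : realType) (mu : probability (measurableTypeR R) R).
Implicit Types f : R -> R.
Local Notation rintegrable f := (mu.-integrable setT (EFin \o f)).

Lemma aeS (P Q : R -> Prop) : (forall x, P x -> Q x) ->
  {ae mu, forall x, P x} -> {ae mu, forall x, Q x}.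
Proof. by move=> PQ; apply: (@filterS _ _ (ae_filter_ringOfSetsType mu)). Qed.

Lemma aeS2 (P Q S : R -> Prop) : (forall x, P x -> Q x -> S x) ->
  {ae mu, forall x, P x} -> {ae mu, forall x, Q x} -> {ae mu, forall x, S x}.
Proof. by move=> PQ; apply: (@filterS2 _ _ (ae_filter_ringOfSetsType mu)). Qed.

Lemma aeE (P : R -> Prop) : (forall x, P x) -> {ae mu, forall x, P x}.
Proof. by move=> H; apply: (@filterE _ _ (ae_filter_ringOfSetsType mu)). Qed.

(** Inversion is continuous only off 0, so the line is split into the open set of nonzero reals and
    the point 0. *)
Lemma measurable_inv : measurable_fun (setT : set (measurableTypeR R)) (@GRing.inv R).
Proof.
have mU : measurable (~` [set (0 : R)] : set (measurableTypeR R)).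
  by apply: measurableC; exact: measurable_set1.
rewrite -(setvU [set (0 : R)]) measurable_funU//; split.
  apply: open_continuous_measurable_fun.
    by apply: closed_openC; exact: closed_eq.
  by move=> x; rewrite inE /= => /eqP x0; exact: inv_continuous.
exact: measurable_fun_set1.
Qed.

Lemma ae_bounded_integrable f K : measurable_fun setT f ->
  {ae mu, forall x, `|f x| <= K} -> rintegrable f.
Proof.
move=> mf fK; apply/integrableP; split; first exact/measurable_EFinP.
(* The sign of [K] is unknown; [|K|] makes the dominating constant nonnegative. *)
apply: (@le_lt_trans _ _ (\int[mu]_(x in setT) (`|K|%:E))%E).
  apply: ae_ge0_le_integral => //=.
  - by do 2 apply: measurableT_comp => //.
  - by apply: aeS fK => x fxK _; rewrite lee_fin (le_trans fxK) ?ler_norm.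
rewrite integral_cst//; set m := (X in (_ * X)%E).
have -> : m = 1%E by exact: probability_setT.
by rewrite mule1 ltry.
Qed.

Lemma Rintegral_prob_cst r : Rintegral mu setT (fun=> r) = r.
Proof.
rewrite Rintegral_cst//; set m := (X in fine X).
have -> : m = 1%E by exact: probability_setT.
by rewrite mulr1.
Qed.

Lemma Rintegral_ae_gt0 f : rintegrable f -> {ae mu, forall x, 0 < f x} ->
  0 < Rintegral mu setT f.
Proof.
move=> intf f0.
have mf : measurable_fun setT (EFin \o f) by case/integrableP : intf.
have E : (\int[mu]_x (f x)%:E = \int[mu]_x `|(f x)%:E|)%E.
  apply: ae_eq_integral => //; first exact: measurableT_comp.
  by apply: aeS f0 => x fx0 _ /=; rewrite gtr0_norm.
rewrite /Rintegral E; apply: fine_gt0; apply/andP; split; last first.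
  by case/integrableP : intf.
rewrite lt_def integral_ge0; last by move=> x _; exact: abse_ge0.
rewrite andbT; apply/eqP => /ae_eq_integral_abs => /(_ measurableT mf) H.
(* A zero integral would make [f] both positive and zero almost everywhere: a null set would then
   cover the whole line, which has mass 1. *)
have HF : {ae mu, forall x : R, False}.
  by apply: aeS2 f0 H => x fx0 /(_ I) [] fx; move: fx0; rewrite fx ltxx.
move: HF => [N [mN N0 sN]].
have : (mu setT <= mu N)%E by apply: le_measure; rewrite ?inE// => x _; apply: sN.
by rewrite N0 probability_setT lee_fin ler10.
Qed.

End real_integrals.

Section complex_integrals.
Variables (R : realType).
Local Notation C := (Cplx R).
Implicit Types (mu : probability (measurableTypeR R) R) (f g : R -> C).

Definition Cmeasurable f :=
  measurable_fun setT (fun x : measurableTypeR R => ReC (f x)) /\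
  measurable_fun setT (fun x : measurableTypeR R => ImC (f x)).

Lemma Cmeasurable_cst c : Cmeasurable (fun=> c).
Proof. by split. Qed.
Lemma Cmeasurable_toC : Cmeasurable (@toC R).
Proof. by split => /=; [exact: measurable_id|exact: measurable_cst]. Qed.
Lemma CmeasurableD f g : Cmeasurable f -> Cmeasurable g ->
  Cmeasurable (fun x => f x + g x).
Proof.
move=> [? ?] [? ?]; split; [under eq_fun do rewrite ReCD|under eq_fun do rewrite ImCD];
  exact: measurable_funD.
Qed.
Lemma CmeasurableN f : Cmeasurable f -> Cmeasurable (fun x => - f x).
Proof.
move=> [? ?]; split; [under eq_fun do rewrite ReCN|under eq_fun do rewrite ImCN];
  exact: measurableT_comp.
Qed.
Lemma CmeasurableM f g : Cmeasurable f -> Cmeasurable g ->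
  Cmeasurable (fun x => f x * g x).
Proof.
move=> [? ?] [? ?]; split.
  by under eq_fun do rewrite ReCM; apply: measurable_funB; apply: measurable_funM.
by under eq_fun do rewrite ImCM; apply: measurable_funD; apply: measurable_funM.
Qed.
Lemma CmeasurableV f : Cmeasurable f -> Cmeasurable (fun x => (f x)^-1).
Proof.
move=> [mr mi].
have m2 : measurable_fun setT
    (fun x : measurableTypeR R => (ReC (f x) ^+ 2 + ImC (f x) ^+ 2)^-1).
  apply: (@measurableT_comp _ _ _ _ _ _ (@GRing.inv R)); first exact: measurable_inv.
  by apply: measurable_funD; exact: measurable_funX.
split; [under eq_fun do rewrite ReCV|under eq_fun do rewrite ImCV].
  exact: measurable_funM.
by apply: measurableT_comp => //; exact: measurable_funM.
Qed.

Definition Cintegrable mu f :=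
  mu.-integrable setT (fun x => (ReC (f x))%:E) /\
  mu.-integrable setT (fun x => (ImC (f x))%:E).

Lemma ae_bounded_Cintegrable mu f K : Cmeasurable f ->
  {ae mu, forall x, nrm (f x) <= K} -> Cintegrable mu f.
Proof.
move=> [mr mi] fK; split; apply: (@ae_bounded_integrable _ _ _ K) => //;
  apply: aeS fK => x; apply: le_trans; [exact: nrm_Re|exact: nrm_Im].
Qed.

Lemma Cintegrable_cst mu c : Cintegrable mu (fun=> c).
Proof.
apply: (@ae_bounded_Cintegrable _ _ (nrm c)); first exact: Cmeasurable_cst.
by apply: aeE.
Qed.

Lemma CintegrableD mu f g : Cintegrable mu f -> Cintegrable mu g ->
  Cintegrable mu (fun x => f x + g x).
Proof.
move=> [? ?] [? ?]; split.
  by under eq_fun do rewrite ReCD EFinD; exact: integrableD.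
by under eq_fun do rewrite ImCD EFinD; exact: integrableD.
Qed.

Lemma CintegrableZ mu f c : Cintegrable mu f -> Cintegrable mu (fun x => c * f x).
Proof.
move=> [? ?]; split.
  by under eq_fun do rewrite ReCM EFinB !EFinM; apply: integrableB => //;
     apply: integrableZl.
by under eq_fun do rewrite ImCM EFinD !EFinM; apply: integrableD => //;
   apply: integrableZl.
Qed.

Lemma CintegralD mu f g : Cintegrable mu f -> Cintegrable mu g ->
  Cintegral mu (fun x => f x + g x) = Cintegral mu f + Cintegral mu g.
Proof.
move=> [? ?] [? ?]; apply: CplxP; rewrite !CE /=.
  by under eq_Rintegral do rewrite ReCD; rewrite RintegralD.
by under eq_Rintegral do rewrite ImCD; rewrite RintegralD.
Qed.

Lemma CintegralZ mu f c : Cintegrable mu f ->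
  Cintegral mu (fun x => c * f x) = c * Cintegral mu f.
Proof.
move=> [f1 f2].
have iZ k (h : R -> R) : mu.-integrable setT (fun x => (h x)%:E) ->
    mu.-integrable setT (fun x => (k * h x)%:E).
  by move=> ih; under eq_fun do rewrite EFinM; exact: integrableZl.
apply: CplxP; rewrite !CE /=.
  under eq_Rintegral do rewrite ReCM.
  by rewrite RintegralB ?RintegralZl//; exact: iZ.
under eq_Rintegral do rewrite ImCM.
by rewrite RintegralD ?RintegralZl//; exact: iZ.
Qed.

Lemma Cintegral_cst mu c : Cintegral mu (fun=> c) = c.
Proof.
by apply: CplxP; rewrite /= Rintegral_prob_cst.
Qed.

(* An open half-plane containing almost all values of f contains its mean; bounds on
   norms, membership in cones and discs all reduce to this. *)
Lemma Cintegral_affine_gt0 mu f a b c : Cintegrable mu f ->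
  {ae mu, forall x, 0 < a * ReC (f x) + b * ImC (f x) + c} ->
  0 < a * ReC (Cintegral mu f) + b * ImC (Cintegral mu f) + c.
Proof.
move=> [f1 f2] H /=.
have i1 : mu.-integrable setT (fun x => (a * ReC (f x))%:E).
  by under eq_fun do rewrite EFinM; exact: integrableZl.
have i2 : mu.-integrable setT (fun x => (b * ImC (f x))%:E).
  by under eq_fun do rewrite EFinM; exact: integrableZl.
have i12 : mu.-integrable setT (fun x => (a * ReC (f x) + b * ImC (f x))%:E).
  by under eq_fun do rewrite EFinD; exact: integrableD.
have i3 : mu.-integrable setT (fun x => (cst c x)%:E).
  exact: finite_measure_integrable_cst.
have i123 : mu.-integrable setT
    (fun x => (a * ReC (f x) + b * ImC (f x) + cst c x)%:E).
  by under eq_fun do rewrite EFinD; exact: integrableD.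
have := Rintegral_ae_gt0 i123 H.
by rewrite RintegralD// RintegralD// !RintegralZl// Rintegral_prob_cst.
Qed.

(** If the mean [I] had modulus above [K], the line orthogonal to [I] at distance [(|I| + K) / 2]
    from 0 would separate [I] from the disc of radius [K] that contains almost all values. *)
Lemma nrm_Cintegral mu f K : Cintegrable mu f ->
  {ae mu, forall x, nrm (f x) <= K} -> nrm (Cintegral mu f) <= K.
Proof.
move=> intf fK; rewrite leNgt; apply/negP; set I := Cintegral mu f => KI.
(* With [K < 0] the bound fails everywhere, so the constant -1 would be almost everywhere positive
   and have a positive integral. *)
have K0 : 0 <= K.
  rewrite leNgt; apply/negP => K0.
  have iN1 : mu.-integrable setT (fun x => (cst (-1) x : R)%:E).
    exact: finite_measure_integrable_cst.
  have : 0 < Rintegral mu setT (cst (-1 : R)).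
    apply: Rintegral_ae_gt0 => //.
    by apply: aeS fK => x fx; move: (le_lt_trans fx K0); rewrite ltNge nrm_ge0.
  by rewrite Rintegral_prob_cst oppr_gt0 ltr10.
have I0 : 0 < nrm I by apply: le_lt_trans KI.
have := @Cintegral_affine_gt0 mu f (- ReC I) (- ImC I) (nrm I * (nrm I + K) / 2) intf.
rewrite -/I => H.
have : 0 < - ReC I * ReC I + - ImC I * ImC I + nrm I * (nrm I + K) / 2.
  apply: H; apply: aeS fK => x fxK.
  have := le_trans (ler_norm _) (nrm_Re (cj I * f x)).
  rewrite nrmM nrm_cj !CE => h.
  have : nrm I * nrm (f x) <= nrm I * K by rewrite ler_pM2l.
  have : nrm I * K < nrm I * nrm I by rewrite ltr_pM2l.
  lra.
have := nrm_sq I; rewrite /sqn !expr2.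
have : nrm I * K < nrm I * nrm I by rewrite ltr_pM2l.
lra.
Qed.

Lemma ae_eq_Cintegral mu f g : Cintegrable mu f -> Cintegrable mu g ->
  {ae mu, forall x, f x = g x} -> Cintegral mu f = Cintegral mu g.
Proof.
move=> fi gi fg; apply/eqP; rewrite -subr_eq0.
have ig := CintegrableZ (-1) gi.
have -> : Cintegral mu f - Cintegral mu g = Cintegral mu (fun x => f x + -1 * g x).
  by rewrite CintegralD// CintegralZ// mulN1r.
rewrite -nrm_eq0 eq_le nrm_ge0 andbT; apply: nrm_Cintegral.
  exact: CintegrableD.
by apply: aeS fg => x ->; rewrite mulN1r subrr -toC0 nrm_toC normr0.
Qed.

End complex_integrals.

(** * The Cauchy transform and the Burgers equation *)

Section cauchy.
Variables (R : realType).
Local Notation C := (Cplx R).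
Implicit Types (mu : probability (measurableTypeR R) R) (z w : C) (x d : R).
Local Notation G := cauchy_transform.

Lemma near_nrm (z : C) e : 0 < e -> \forall h \near z, nrm (h - z) < e.
Proof.
move=> e0; have /cvgC_nrmP/(_ _ e0) : id @ z --> z by exact: cvg_id.
by apply: filterS => h; rewrite -nrmN opprB.
Qed.

Lemma near0_nrm e : 0 < e -> \forall h \near (0 : C), nrm h < e.
Proof. by move=> e0; apply: filterS (near_nrm 0 e0) => h; rewrite subr0. Qed.

Lemma resolvent_neq0 z x : ImC z != 0 -> z - toC x != 0.
Proof. by move=> z0; apply: neq0_Im; rewrite !CE subr0. Qed.

Lemma nrm_resolvent d z x : 0 < d -> d <= `|ImC z| -> nrm (z - toC x)^-1 <= d^-1.
Proof.
move=> d0 dz; rewrite nrmV lef_pV2 ?posrE//.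
  by rewrite (le_trans dz)//; have := nrm_Im (z - toC x); rewrite !CE subr0.
by rewrite nrm_gt0 resolvent_neq0// -normr_gt0 (lt_le_trans d0).
Qed.

Lemma Cmeasurable_resolvent z : Cmeasurable (fun x => (z - toC x)^-1).
Proof.
apply/CmeasurableV/CmeasurableD; first exact: Cmeasurable_cst.
exact/CmeasurableN/Cmeasurable_toC.
Qed.

Lemma Cintegrable_resolvent mu z : ImC z != 0 ->
  Cintegrable mu (fun x => (z - toC x)^-1).
Proof.
move=> z0; apply: (@ae_bounded_Cintegrable _ _ _ `|ImC z|^-1).
  exact: Cmeasurable_resolvent.
by apply: aeE => x; apply: nrm_resolvent; rewrite ?normr_gt0.
Qed.

Definition cauchy_deriv mu z := - Cintegral mu (fun x => (z - toC x)^-1 ^+ 2).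

Lemma nrm_resolvent2 d z x : 0 < d -> d <= `|ImC z| ->
  nrm ((z - toC x)^-1 ^+ 2) <= (d ^+ 2)^-1.
Proof.
by move=> d0 dz; rewrite expr2 nrmM -exprVn expr2 ler_pM ?nrm_ge0// nrm_resolvent.
Qed.

Lemma Cintegrable_resolvent2 mu z : ImC z != 0 ->
  Cintegrable mu (fun x => (z - toC x)^-1 ^+ 2).
Proof.
move=> z0; apply: (@ae_bounded_Cintegrable _ _ _ (`|ImC z| ^+ 2)^-1).
  by apply: CmeasurableM; exact: Cmeasurable_resolvent.
by apply: aeE => x; apply: nrm_resolvent2; rewrite ?normr_gt0.
Qed.

Lemma nrm_cauchy_deriv d mu z : 0 < d -> d <= `|ImC z| ->
  nrm (cauchy_deriv mu z) <= (d ^+ 2)^-1.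
Proof.
move=> d0 dz; rewrite /cauchy_deriv nrmN; apply: nrm_Cintegral.
  by apply: Cintegrable_resolvent2; rewrite -normr_gt0 (lt_le_trans d0).
by apply: aeE => x; exact: nrm_resolvent2.
Qed.

(** The Taylor remainder of one resolvent is exactly [(w - z)^2 (w - x)^-1 (z - x)^-2], and each
    resolvent is at most [1/d]. The bound does not depend on [mu], which matters because the measure
    changes along a characteristic. *)
Lemma cauchy_taylor d mu z w : 0 < d -> d <= `|ImC z| -> d <= `|ImC w| ->
  nrm (G mu w - G mu z - (w - z) * cauchy_deriv mu z) <=
    nrm (w - z) ^+ 2 / d ^+ 3.
Proof.
move=> d0 dz dw.
have z0 : ImC z != 0 by rewrite -normr_gt0 (lt_le_trans d0).
have w0 : ImC w != 0 by rewrite -normr_gt0 (lt_le_trans d0).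
have iz := Cintegrable_resolvent mu z0; have iw := Cintegrable_resolvent mu w0.
have iz2 := Cintegrable_resolvent2 mu z0.
have -> : G mu w - G mu z - (w - z) * cauchy_deriv mu z =
  Cintegral mu (fun x => (w - toC x)^-1 +
    ((-1) * (z - toC x)^-1 + (w - z) * (z - toC x)^-1 ^+ 2)).
  rewrite CintegralD//; last by apply: CintegrableD; exact: CintegrableZ.
  rewrite CintegralD ?CintegralZ//; try exact: CintegrableZ.
  by rewrite /cauchy_deriv /cauchy_transform; ring.
apply: nrm_Cintegral.
  by do 2?[apply: CintegrableD => //]; exact: CintegrableZ.
apply: aeE => x.
have zx := resolvent_neq0 x z0; have wx := resolvent_neq0 x w0.
have -> : (w - toC x)^-1 + (-1 * (z - toC x)^-1 + (w - z) * (z - toC x)^-1 ^+ 2)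
  = (w - z) ^+ 2 * ((w - toC x)^-1 * (z - toC x)^-1 ^+ 2).
  by field; rewrite zx wx.
rewrite nrmM expr2 nrmM -expr2 ler_wpM2l ?sqr_ge0// nrmM exprS invfM.
by rewrite ler_pM ?nrm_ge0// ?nrm_resolvent// nrm_resolvent2.
Qed.

Lemma derive1_cauchy mu z : ImC z != 0 ->
  derive1 (G mu : C -> C) z = cauchy_deriv mu z.
Proof.
move=> z0; apply: cvg_lim => //; apply: cvgC_nrm => e e0.
pose d := `|ImC z| / 2; have d0 : 0 < d by rewrite divr_gt0 ?normr_gt0.
(* The first bound keeps [h + z] at distance at least [d] from the real axis; the second makes the
   remainder divided by [h], at most [|h| / d^3], smaller than [e]. *)
pose e' := Num.min d (e * d ^+ 3).
have e'0 : 0 < e' by rewrite lt_min d0 mulr_gt0 ?exprn_gt0.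
near=> h.
have h0 : h != 0 by near: h; exact: nbhs_dnbhs_neq.
have : nrm h < e'.
  by near: h; apply: nbhs_dnbhs; exact: near0_nrm.
rewrite lt_min => /andP[hd he].
have dz : d <= `|ImC z| by rewrite /d; have := normr_ge0 (ImC z); lra.
have dw : d <= `|ImC (h + z)|.
  have := nrm_Im h; rewrite CE; have := ler_normB (ImC h + ImC z) (ImC h).
  by rewrite addrC addKr /d; move: hd; rewrite /d; lra.
have := cauchy_taylor mu d0 dz dw.
set T := (X in nrm X <= _) => hT.
have -> : cauchy_deriv mu z - h^-1 *: (G mu (h + z) - G mu z) = - (h^-1 * T).
  by rewrite /T /GRing.scale /= addrK; field.
rewrite nrmN nrmM nrmV (le_lt_trans (ler_wpM2l _ hT)) ?invr_ge0 ?nrm_ge0//.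
rewrite addrK -nrm_gt0 in h0 *.
have -> : (nrm h)^-1 * (nrm h ^+ 2 / d ^+ 3) = nrm h / d ^+ 3.
  by field; rewrite !gt_eqF.
by rewrite ltr_pdivrMr ?exprn_gt0.
Unshelve. all: by end_near. Qed.

End cauchy.

Section gronwall.
Variable R : realType.

(** Multiplied by [exp(L s)], the function [E] becomes nondecreasing on [[0, t]], so [E 0] is at
    most [exp(L t) E t = 0]. At 0 only right continuity is asked, since the evolution is one-sided
    there. *)
Lemma backward_gronwall (E E' : R -> R) (L t : R) : 0 < t ->
  (forall s, 0 < s -> s <= t -> is_derive s (1 : R) E (E' s)) ->
  E h @[h --> 0^'+] --> E 0 ->
  (forall s, 0 < s -> s < t -> - (L * E s) <= E' s) ->
  E t = 0 -> E 0 <= 0.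
Proof.
move=> t0 dE E0 LE Et.
pose phi s := expR (L * s) * E s.
pose phi' s := expR (L * s) * (E' s + L * E s).
have dphi s : 0 < s -> s <= t -> is_derive s (1 : R) phi (phi' s).
  move=> s0 st; have := dE _ s0 st => dEs.
  have d1 : is_derive s (1 : R) (fun s => L * s) L.
    by apply: is_derive_eq; rewrite /GRing.scale /= mulr1.
  have d2 := @is_derive1_comp _ _ _ _ _ _ (is_derive_expR (L * s)) d1.
  apply: (is_derive_eq (is_deriveM d2 dEs)).
  by rewrite /phi' /GRing.scale /=; ring.
have cphi s : 0 < s -> s <= t -> {for s, continuous phi}.
  move=> s0 st; apply: differentiable_continuous; apply/derivable1_diffP.
  by have [] := dphi _ s0 st.
have cw : {within `[0, t], continuous phi}.
  apply/continuous_within_itvP => //; split.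
  - by move=> s; rewrite in_itv /= => /andP[s0 /ltW st]; exact: cphi.
  - apply: cvgM => //; apply: cvg_at_right_filter.
    apply: continuous_comp; last exact: continuous_expR.
    exact: mulrl_continuous.
  - apply: cvg_at_left_filter; exact: cphi.
have := @ger0_derive1_ndecr _ phi 0 t _ _ cw 0 t (lexx _) (ltW t0) (lexx _).
rewrite /phi Et mulr0 mulr0 expR0 mul1r; apply.
  by move=> s; rewrite in_itv /= => /andP[s0 /ltW st]; have [] := dphi _ s0 st.
move=> s; rewrite in_itv /= => /andP[s0 st]; rewrite derive1E.
have [_ ->] := dphi _ s0 (ltW st).
by rewrite mulr_ge0 ?expR_ge0// -lerBlDr sub0r LE.
Qed.

End gronwall.

Section burgers.
Variables (R : realType).
Local Notation C := (Cplx R).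
Implicit Types (mu : probability (measurableTypeR R) R) (z : C) (x d s t : R).
Local Notation G := cauchy_transform.

Lemma ImC_cauchy_lt0 mu z : 0 < ImC z -> ImC (G mu z) < 0.
Proof.
move=> z0; have := @Cintegral_affine_gt0 _ mu _ 0 (-1) 0
  (Cintegrable_resolvent mu (lt0r_neq0 z0)).
rewrite !mul0r !add0r !addr0 mulN1r oppr_gt0; apply.
apply: aeE => x; rewrite mul0r add0r addr0 mulN1r ImCV opprK divr_gt0 ?CE ?subr0//.
have := @sqn_gt0 _ (z - toC x); rewrite /sqn !CE subr0; apply.
by apply: resolvent_neq0; rewrite gt_eqF.
Qed.

Variable w : R -> probability (measurableTypeR R) R.

(** The filter of time increments from [solves_burgers]: near 0 it is two-sided for [s > 0] and
    one-sided for [s = 0], so both cases are treated together. *)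
Definition increments s := within [set h : R | 0 <= s + h] (0 : R)^'.

Instance increments_filter s : Filter (increments s).
Proof. exact: within_filter. Qed.

Lemma increments_shift s : (fun h => s + h) @ increments s -->
  within [set t : R | 0 <= t] (nbhs s).
Proof.
move=> U /= HU; rewrite /increments /nbhs /= /within /=.
have : \forall h \near (0:R), 0 <= s + h -> U (s + h).
  have : (fun h => s + h) @ (0:R) --> s + 0.
    by apply: cvgD; [exact: cvg_cst|exact: cvg_id].
  by rewrite addr0 => /(_ _ HU).
exact: nbhs_dnbhs.
Qed.

Lemma increments_near_dnbhs s (P : R -> Prop) : (\forall h \near (0 : R)^', P h) ->
  \forall h \near increments s, P h.
Proof. by move=> H; rewrite /increments near_withinE; apply: filterS H => h Ph _. Qed.

Lemma increments_near s (P : R -> Prop) : (\forall h \near (0 : R), P h) ->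
  \forall h \near increments s, P h.
Proof. by move=> H; apply: increments_near_dnbhs; exact: nbhs_dnbhs. Qed.

Lemma increments_neq0 s : \forall h \near increments s, h != 0.
Proof. by apply: increments_near_dnbhs; exact: nbhs_dnbhs_neq. Qed.

Hypothesis wcont : weakly_continuous w.

Lemma Cintegral_weak_cvg (f : R -> C) K s : 0 <= s -> continuous f ->
  (forall x, nrm (f x) <= K) ->
  Cintegral (w (s + h)) f @[h --> increments s] --> Cintegral (w s) f.
Proof.
move=> s0 cf fK.
have key (g : R -> R) : continuous g -> (forall x, `|g x| <= K) ->
    Rintegral (w (s + h)) setT g @[h --> increments s] --> Rintegral (w s) setT g.
  move=> cg gK; have H := wcont cg (ex_intro _ K gK).
  suff H1 : Rintegral (w t) setT g @[t --> within [set t : R | 0 <= t] (nbhs s)]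
      --> Rintegral (w s) setT g.
    exact: (cvg_comp _ _ (@increments_shift s) H1).
  have := H s; rewrite /continuous_at.
  have -> : nbhs (s : subspace [set t : R | 0 <= t]) = within [set t | 0 <= t] (nbhs s).
    by rewrite nbhs_subspace_in.
  by [].
apply: cvg_ReIm => /=; apply: key.
- by move=> x; apply: (@cvg_ReC _ _ _ (nbhs_filter x)); exact: cf.
- by move=> x; exact: le_trans (nrm_Re _) (fK x).
- by move=> x; apply: (@cvg_ImC _ _ _ (nbhs_filter x)); exact: cf.
- by move=> x; exact: le_trans (nrm_Im _) (fK x).
Qed.

(** Expanding [G (w (s + h))] in space produces the derivative at time [s + h], whereas the limit
    has to involve time [s]. The squared resolvent is a bounded continuous test function off the
    real axis. *)
Lemma cauchy_deriv_cvg z s : 0 <= s -> ImC z != 0 ->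
  cauchy_deriv (w (s + h)) z @[h --> increments s] --> cauchy_deriv (w s) z.
Proof.
move=> s0 z0; rewrite /cauchy_deriv; apply: cvgN.
apply: (@Cintegral_weak_cvg _ (`|ImC z| ^+ 2)^-1) => //.
  move=> x; have cV : (z - toC y)^-1 @[y --> x] --> (z - toC x)^-1.
    apply: (@cvgV _ _ _ (nbhs_filter x)); first exact: resolvent_neq0.
    exact: (@cvgB _ _ _ _ (nbhs_filter x) (fun=> z) (@toC R) _ _ (cvg_cst _)
      (@continuous_toC R x)).
  exact: (cvgM cV cV).
by move=> x; apply: nrm_resolvent2; rewrite ?normr_gt0.
Qed.

Hypothesis wburgers : solves_burgers w.

(** The increment along the moving point splits into the Taylor remainder [T h], the linear term
    [h u] times the space derivative at time [s + h], and the time increment at fixed [z], whose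
    quotient tends to [- G G']. *)
Lemma characteristic_deriv (u z : C) s : 0 <= s -> 0 < ImC z ->
  (toC h)^-1 * (G (w (s + h)) (z + toC h * u) - G (w s) z)
    @[h --> increments s] --> - cauchy_deriv (w s) z * (G (w s) z - u).
Proof.
move=> s0 z0.
pose T h := G (w (s + h)) (z + toC h * u) - G (w (s + h)) z
  - (toC h * u) * cauchy_deriv (w (s + h)) z.
have H1 := @cauchy_deriv_cvg z s s0 (lt0r_neq0 z0).
have H2 := wburgers s0 z0; rewrite (derive1_cauchy (w s) (lt0r_neq0 z0)) in H2.
pose d := ImC z / 2; have d0 : 0 < d by rewrite divr_gt0.
have H3 : (toC h)^-1 * T h @[h --> increments s] --> (0 : C).
  apply: cvgC_nrm => e e0.
  (* The 1 makes [k] a positive divisor even when [u = 0]. The first bound on [h] keeps [z + h u] at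
     height at least [d]; the second makes [|h| k^2 / d^3] smaller than [e]. *)
  pose k := 1 + nrm u; have k0 : 0 < k by rewrite ltr_pwDl ?nrm_ge0.
  have n1 : \forall h \near increments s, `|h| < d / k.
    by apply: increments_near; apply: nbhs0_lt; rewrite divr_gt0.
  have n2 : \forall h \near increments s, `|h| < e * d ^+ 3 / k ^+ 2.
    by apply: increments_near; apply: nbhs0_lt; rewrite divr_gt0 ?mulr_gt0 ?exprn_gt0.
  near=> h.
  have h0 : h != 0 by near: h; exact: increments_neq0.
  have h1 : `|h| < d / k by near: h.
  have h2 : `|h| < e * d ^+ 3 / k ^+ 2 by near: h.
  have hu : nrm (toC h * u) <= `|h| * k.
    by rewrite nrmM nrm_toC ler_wpM2l// lerDr.
  have hk : `|h| * k < d by rewrite -ltr_pdivlMr.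
  have dz : d <= `|ImC z| by rewrite gtr0_norm// /d; lra.
  have dw : d <= `|ImC (z + toC h * u)|.
    have := nrm_Im (toC h * u); rewrite ImCD.
    have := ler_norm (ImC z + ImC (toC h * u)); have := ler_norm (- ImC (toC h * u)).
    by rewrite normrN /d; move: hk hu; rewrite /d; lra.
  have hu' : z + toC h * u - z = toC h * u by ring.
  have := cauchy_taylor (w (s + h)) d0 dz dw; rewrite hu' -/(T h) => hT.
  rewrite sub0r nrmN nrmM nrmV nrm_toC.
  have h0' : 0 < `|h| by rewrite normr_gt0.
  rewrite mulrC ltr_pdivrMr// (le_lt_trans hT)// ltr_pdivrMr ?exprn_gt0//.
  have : nrm (toC h * u) ^+ 2 <= (`|h| * k) ^+ 2.
    by rewrite lerXn2r ?nnegrE ?nrm_ge0 ?mulr_ge0 ?(ltW k0).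
  move=> /le_lt_trans; apply.
  rewrite ltr_pdivlMr ?exprn_gt0// in h2.
  have -> : (`|h| * k) ^+ 2 = `|h| * (`|h| * k ^+ 2) by ring.
  have -> : e * `|h| * d ^+ 3 = `|h| * (e * d ^+ 3) by ring.
  by rewrite ltr_pM2l.
have E : \forall h \near increments s, u * cauchy_deriv (w (s + h)) z
    + (toC h)^-1 * T h + (toC h)^-1 * (G (w (s + h)) z - G (w s) z)
    = (toC h)^-1 * (G (w (s + h)) (z + toC h * u) - G (w s) z).
  apply: filterS (increments_neq0 s) => h; rewrite -toC_eq0 => h0.
  by rewrite /T; field.
apply: cvg_trans; first exact: near_eq_cvg E.
have -> : - cauchy_deriv (w s) z * (G (w s) z - u) =
  u * cauchy_deriv (w s) z + 0 - G (w s) z * cauchy_deriv (w s) z by ring.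
apply: cvgD; last exact: H2.
apply: cvgD; last exact: H3.
apply: cvgM; [exact: cvg_cst|exact: H1].
Unshelve. all: by end_near. Qed.

Lemma backward_characteristic z t : 0 <= t -> 0 < ImC z ->
  G (w 0) (z - toC t * G (w t) z) = G (w t) z.
Proof.
rewrite le_eqVlt => /orP[/eqP<- _|t0 z0]; first by rewrite toC0 mul0r subr0.
set u := G (w t) z; have u0 : ImC u < 0 by exact: ImC_cauchy_lt0.
pose c s : C := z - toC t * u + toC s * u.
have cE s : ImC (c s) = ImC z + (t - s) * - ImC u by rewrite /c !CE; ring.
have zc s : s <= t -> ImC z <= ImC (c s).
  by move=> st; rewrite cE lerDl mulr_ge0 ?subr_ge0// oppr_ge0 ltW.
have c0 s : s <= t -> 0 < ImC (c s) by move=> /zc; exact: lt_le_trans.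
pose D s := G (w s) (c s) - u.
pose D' s := - cauchy_deriv (w s) (c s) * D s.
have dD s : 0 <= s -> s <= t ->
    (toC h)^-1 * (D (s + h) - D s) @[h --> increments s] --> D' s.
  move=> s0 st; have := characteristic_deriv (u := u) s0 (c0 _ st).
  apply: cvg_trans; apply: near_eq_cvg; near=> h.
  by rewrite /D /c toCD mulrDl !addrA; ring.
have dReIm s : 0 < s -> s <= t ->
    is_derive s (1 : R) (fun s => ReC (D s)) (ReC (D' s)) /\
    is_derive s (1 : R) (fun s => ImC (D s)) (ImC (D' s)).
  move=> s0 st; have H := dD _ (ltW s0) st.
  (* For [s > 0] every small [h] satisfies [0 <= s + h], so the restricted limit is an ordinary
     two-sided derivative. *)
  have {}H : (toC h)^-1 * (D (s + h) - D s) @[h --> (0 : R)^'] --> D' s.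
    move=> U /H; rewrite /increments /nbhs /= /within /= => HU.
    have : \forall h \near (0 : R)^', 0 <= s + h.
      apply: nbhs_dnbhs; have := @nbhs0_lt R R s s0; apply: filterS => h.
      by rewrite ltr_norml => /andP[]; lra.
    by apply: filterS2 HU => h; exact.
  have HR := cvg_ReC H; have HI := cvg_ImC H.
  have E1 : (fun h => h^-1 *: (ReC (D (h *: 1 + s)) - ReC (D s))) @ 0^' --> ReC (D' s).
    rewrite (_ : (fun h => _) = (fun h => ReC ((toC h)^-1 * (D (s + h) - D s)))).
      exact: HR.
    by apply/funext => h; rewrite -toCV !CE mul0r subr0 /GRing.scale /= mulr1 [h + s]addrC.
  have E2 : (fun h => h^-1 *: (ImC (D (h *: 1 + s)) - ImC (D s))) @ 0^' --> ImC (D' s).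
    rewrite (_ : (fun h => _) = (fun h => ImC ((toC h)^-1 * (D (s + h) - D s)))).
      exact: HI.
    by apply/funext => h; rewrite -toCV !CE mul0r addr0 /GRing.scale /= mulr1 [h + s]addrC.
  by split; apply: DeriveDef;
    [exact: cvgP E1|exact: cvg_lim E1|exact: cvgP E2|exact: cvg_lim E2].
(* The squared modulus is real and remains differentiable where [D] vanishes, as it does at
   [s = t]. *)
pose E s := sqn (D s).
pose E' s := - 2 * ReC (cauchy_deriv (w s) (c s)) * E s.
have dE s : 0 < s -> s <= t -> is_derive s (1 : R) E (E' s).
  move=> s0 st; have [d1 d2] := dReIm _ s0 st.
  have -> : E = (fun s => ReC (D s)) * (fun s => ReC (D s)) +
                (fun s => ImC (D s)) * (fun s => ImC (D s)).
    by apply/funext => r; rewrite /E /sqn !expr2.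
  apply: (is_derive_eq (is_deriveD (is_deriveM d1 d1) (is_deriveM d2 d2))).
  by rewrite /E' /E /sqn /D' /GRing.scale /= !CE; ring.
(* Right continuity at 0 follows from the one-sided derivative, since [D h - D 0] is [h] times the
   difference quotient. *)
have D0 : D h @[h --> 0^'+] --> D 0.
  have H0 := dD 0 (lexx _) (ltW t0).
  have H1 : toC h * ((toC h)^-1 * (D (0 + h) - D 0)) + D 0
      @[h --> increments 0] --> toC 0 * D' 0 + D 0.
    apply: cvgD; last exact: cvg_cst.
    apply: cvgM; last exact: H0.
    apply: cvg_toC => U HU.
    by apply: (@increments_near 0 U).
  rewrite toC0 mul0r add0r in H1.
  have {}H1 : D h @[h --> increments 0] --> D 0.
    apply: cvg_trans H1; apply: near_eq_cvg.
    apply: filterS (increments_neq0 0) => h; rewrite -toC_eq0 => h0.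
    by rewrite mulVKf// add0r subrK.
  apply: cvg_trans H1; apply: cvg_app => U HU.
  have {}HU : \forall h \near increments 0, U h by [].
  rewrite /increments near_withinE /dnbhs near_withinE in HU.
  suff : \forall h \near (0 : R)^'+, U h by [].
  rewrite /at_right near_withinE; apply: filterS HU => h HU h0.
  by apply: HU; [rewrite gt_eqF|rewrite /= add0r ltW].
have E0 : E h @[h --> 0^'+] --> E 0.
  have HR := cvg_ReC D0; have HI := cvg_ImC D0.
  have -> : E = (fun s => ReC (D s) * ReC (D s) + ImC (D s) * ImC (D s)).
    by apply/funext => r; rewrite /E /sqn !expr2.
  apply: cvgD; apply: cvgM; [exact: HR|exact: HR|exact: HI|exact: HI].
have Et : E t = 0.
  by rewrite /E /D /c subrK subrr /sqn !CE mul0r addr0.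
(* The whole characteristic stays at height at least [Im z], so [|G_s'|] is at most [1 / (Im z)^2]
   on it; the factor 2 comes from differentiating a square. *)
have := @backward_gronwall R E E' (2 * (ImC z ^+ 2)^-1) t t0 dE E0 _ Et.
move=> H; have : E 0 <= 0.
  apply: H => s s0 st; have := nrm_cauchy_deriv (w s) z0.
  have := zc _ (ltW st) => /[dup] zcs /(le_trans) /(_ (ler_norm _)) hz /(_ _ hz).
  move=> /(le_trans (nrm_Re _)) /(le_trans (ler_norm _)) hL.
  have /(ler_wpM2r (sqn_ge0 (D s))) := hL; rewrite /E' -/(E s); lra.
have := sqn_ge0 (D 0); rewrite -/(E 0) => h1 h2.
have : D 0 == 0.
  by rewrite -nrm_eq0 /nrm -/(E 0) ler0_sqrtr.
by rewrite /D /c toC0 mul0r addr0 subr_eq0 => /eqP.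
Unshelve. all: by end_near. Qed.

End burgers.

(** * Principal square root *)

Section principal_square_root.
Variable R : realType.
Local Notation C := (Cplx R).
Implicit Types z w : C.

(** The sign of [sqrtc] is normalised so that the real part is nonnegative; the resulting branch is
    analytic on [Re z > 0]. *)
Definition csqrt z : C :=
  if 0 <= ReC (sqrtc z : C) then (sqrtc z : C) else - (sqrtc z : C).

Lemma sqr_csqrt z : csqrt z ^+ 2 = z.
Proof. by rewrite /csqrt; case: ifP => _; rewrite ?sqrrN; exact: sqr_sqrtc. Qed.

Lemma csqrt_ge0 z : 0 <= ReC (csqrt z).
Proof.
by rewrite /csqrt; case: ifPn => // H; rewrite ReCN oppr_ge0 ltW// ltNge.
Qed.

(** This is how the signs of square roots are settled below: the other root [- w] has negative real
    part. *)
Lemma csqrt_eq w z : 0 < ReC w -> w ^+ 2 = z -> csqrt z = w.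
Proof.
move=> w0 E; have := sqr_csqrt z; rewrite -{2}E => /eqP; rewrite eqf_sqr.
by case/orP => /eqP // H; have := csqrt_ge0 z; rewrite H ReCN leNgt oppr_lt0 w0.
Qed.

Lemma csqrt1 : csqrt 1 = 1.
Proof. by apply: csqrt_eq; rewrite ?expr1n// ltr01. Qed.

Lemma csqrt_gt0 z : 0 < ReC z -> 0 < ReC (csqrt z).
Proof.
move=> z0; rewrite lt_def csqrt_ge0 andbT; apply/eqP => E.
have := sqr_csqrt z => /(congr1 (@ReC R)); rewrite !CE E mul0r sub0r.
by have := sqr_ge0 (ImC (csqrt z)); rewrite expr2; lra.
Qed.

Lemma csqrt_Im z : 0 < ReC z -> `|ImC (csqrt z)| < ReC (csqrt z).
Proof.
move=> z0; rewrite -(gtr0_norm (csqrt_gt0 z0)) -ltr_sqr ?nnegrE ?normr_ge0//.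
rewrite !real_normK ?num_real//.
by move: z0; rewrite -{1}(sqr_csqrt z) !CE subr_gt0.
Qed.

Lemma csqrt_neq0 z : 0 < ReC z -> csqrt z != 0.
Proof. by move=> z0; apply: neq0_Re; rewrite gt_eqF// csqrt_gt0. Qed.

(** In [(csqrt w - csqrt z) (csqrt w + csqrt z) = w - z] the second factor has real part at least
    [Re (csqrt z) > 0]. The same factorisation then gives the derivative. *)
Lemma csqrt_cont z : 0 < ReC z -> csqrt w @[w --> z] --> csqrt z.
Proof.
move=> z0; apply: (@cvgC_nrm _ _ _ (nbhs_filter z)) => e e0; have s0 := csqrt_gt0 z0.
have H1 := near_nrm z (mulr_gt0 e0 s0).
apply: (@filterS _ _ (nbhs_filter z)) H1 => w hw.
have E : (csqrt w - csqrt z) * (csqrt w + csqrt z) = w - z.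
  by rewrite -subr_sqr !sqr_csqrt.
have ge : ReC (csqrt z) <= nrm (csqrt w + csqrt z).
  apply: le_trans (nrm_Re _); rewrite CE ger0_norm ?lerDr ?csqrt_ge0//.
  by rewrite addr_ge0 ?csqrt_ge0.
rewrite -nrmN opprB -(ltr_pM2r s0); apply: le_lt_trans hw.
by rewrite -E nrmM ler_wpM2l ?nrm_ge0.
Qed.

Lemma derivable_csqrt z : 0 < ReC z -> derivable (csqrt : C -> C) z 1.
Proof.
move=> z0; have s0 := csqrt_neq0 z0.
have H : (csqrt (h + z) + csqrt z)^-1 @[h --> (0 : C)^'] --> (csqrt z + csqrt z)^-1.
  apply: cvgV; first by apply: neq0_Re; rewrite CE gt_eqF// addr_gt0 ?csqrt_gt0.
  apply: cvgD; last exact: cvg_cst.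
  have H1 : (h + z) @[h --> (0 : C)^'] --> z.
    rewrite -[X in _ --> X]add0r; apply: cvgD; last exact: cvg_cst.
    exact: nbhs_dnbhs.
  exact: (cvg_comp _ _ H1 (csqrt_cont z0)).
apply/cvg_ex; exists (csqrt z + csqrt z)^-1.
apply: cvg_trans H; apply: near_eq_cvg; near=> h.
have h0 : h != 0 by near: h; exact: nbhs_dnbhs_neq.
have E : (csqrt (h + z) - csqrt z) * (csqrt (h + z) + csqrt z) = h.
  by rewrite -subr_sqr !sqr_csqrt addrK.
have E0 : csqrt (h + z) + csqrt z != 0.
  by apply: contraNneq h0 => E0; rewrite -E E0 mulr0.
rewrite /GRing.scale /= mulr1.
apply: (mulIf E0); rewrite mulVf// -mulrA E mulVf//.
Unshelve. all: by end_near. Qed.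

Lemma derivable_csqrt_comp (f : C -> C) z : derivable f z 1 -> 0 < ReC (f z) ->
  derivable (fun z => csqrt (f z)) z 1.
Proof.
move=> /derivable1_diffP df fz0; apply/derivable1_diffP.
have /derivable1_diffP dc := derivable_csqrt fz0.
exact: (@differentiable_comp _ _ _ _ f csqrt z df dc).
Qed.

Definition holo (f : C -> C) z := derivable f z 1.

Lemma holo_cst c z : holo (fun=> c) z.
Proof. exact: derivable_cst. Qed.
Lemma holo_id z : holo (fun z => z) z.
Proof. exact: derivable_id. Qed.
Lemma holoD f g z : holo f z -> holo g z -> holo (fun z => f z + g z) z.
Proof. by move=> hf hg; exact: (derivableD hf hg). Qed.
Lemma holoN f z : holo f z -> holo (fun z => - f z) z.
Proof. by move=> hf; exact: (derivableN hf). Qed.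
Lemma holoM f g z : holo f z -> holo g z -> holo (fun z => f z * g z) z.
Proof. by move=> hf hg; exact: (derivableM hf hg). Qed.
Lemma holo_sqr f z : holo f z -> holo (fun z => f z ^+ 2) z.
Proof. by move=> hf; under eq_fun do rewrite expr2; exact: holoM. Qed.
Lemma holoV f z : f z != 0 -> holo f z -> holo (fun z => (f z)^-1) z.
Proof. by move=> fz hf; exact: (derivableV fz hf). Qed.

Lemma csqrtM_toC (x : R) z : 0 < x -> 0 < ReC z ->
  csqrt (toC x * z) = toC (Num.sqrt x) * csqrt z.
Proof.
move=> x0 z0; apply: csqrt_eq.
  by rewrite !CE mul0r subr0 mulr_gt0 ?sqrtr_gt0 ?csqrt_gt0.
by rewrite exprMn sqr_csqrt -toCX sqr_sqrtr// ltW.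
Qed.

End principal_square_root.

(** * Subordination to the Bernoulli law and the R-transform *)

Section bernoulli.
Variables (R : realType) (a : R) (nu : probability (measurableTypeR R) R).
Local Notation C := (Cplx R).
Implicit Types z : C.
Hypothesis a0 : 0 < a.
Hypothesis nuE : forall A : set R, measurable A -> nu A = sym_bernoulli a A.

Let aNa : a != - a. Proof. by rewrite -subr_eq0 opprK gt_eqF ?addr_gt0. Qed.

Lemma bernoulli_ae : {ae nu, forall x, x = a \/ x = - a}.
Proof.
exists (~` ([set a] `|` [set - a])); split.
- by apply: measurableC; apply: measurableU; exact: measurable_set1.
- apply: (etrans (nuE _)).
    by apply: measurableC; apply: measurableU; exact: measurable_set1.
  rewrite /sym_bernoulli !diracE !memNset ?mule0 ?adde0//=; apply; by [left|right].
- by move=> x /= H; apply: contra_not H.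
Qed.

(** [nuE] describes [nu] set by set, so [f] is replaced, almost everywhere, by a constant plus a
    multiple of the indicator of [a], whose integral is the mass of one atom. *)
Lemma Rintegral_bernoulli (f : R -> R) : measurable_fun setT f ->
  Rintegral nu setT f = (f (- a) + f a) / 2.
Proof.
move=> mf.
have ma : measurable ([set a] : set (measurableTypeR R)) by exact: measurable_set1.
pose g x := f (- a) + (f a - f (- a)) * \1_[set a] x.
have i1 : nu.-integrable setT (fun x => (\1_[set a] x : R)%:E).
  exact: integrable_indic.
have i2 : nu.-integrable setT (fun x => ((f a - f (- a)) * \1_[set a] x)%:E).
  by under eq_fun do rewrite EFinM; exact: integrableZl.
have i3 : nu.-integrable setT (fun x => (cst (f (- a)) x)%:E).
  exact: finite_measure_integrable_cst.
have mg : measurable_fun setT g.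
  apply: measurable_funD; first exact: measurable_cst.
  by apply: measurable_funM => //; exact: measurable_indic.
have -> : Rintegral nu setT f = Rintegral nu setT g.
  congr fine; apply: ae_eq_integral => //; try exact/measurable_EFinP.
  apply: aeS bernoulli_ae => x [] -> _; rewrite /g indicE.
    by rewrite mem_set//= mulr1 addrC subrK.
  by rewrite memNset/= ?mulr0 ?addr0// => E; move/eqP: aNa; rewrite E.
rewrite /g (RintegralD measurableT i3 i2) Rintegral_prob_cst RintegralZl//.
have -> : Rintegral nu setT (\1_[set a] : R -> R) = 2^-1.
  rewrite /Rintegral integral_indic// setIT; set m := (X in fine X).
  have -> : m = sym_bernoulli a [set a] by exact: nuE.
  rewrite /sym_bernoulli !diracE.
  rewrite (@mem_set _ [set a] a)// (@memNset _ [set a] (- a)).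
    by rewrite /= mulr0 add0r mulr1.
  by move=> E; move/eqP: aNa; rewrite {1}E.
by field.
Qed.

Lemma cauchy_bernoulli z : ImC z != 0 ->
  cauchy_transform nu z = z / (z ^+ 2 - toC a ^+ 2).
Proof.
move=> z0; have [m1 m2] := @Cmeasurable_resolvent R z.
have n1 := resolvent_neq0 a z0; have n2 := resolvent_neq0 (- a) z0.
have n3 : z ^+ 2 - toC a ^+ 2 != 0.
  by rewrite subr_sqr mulf_neq0//; move: n2; rewrite toCN opprK.
have -> : z / (z ^+ 2 - toC a ^+ 2) =
    toC 2^-1 * ((z - toC (- a))^-1 + (z - toC a)^-1).
  rewrite toCV -natC; field.
  by rewrite n3 n1 andbT; move: n2; rewrite toCN opprK.
apply: CplxP; rewrite /cauchy_transform /Cintegral /=.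
  by rewrite (Rintegral_bernoulli m1) ReCM ReC_toC ImC_toC mul0r subr0 mulrC ReCD.
by rewrite (Rintegral_bernoulli m2) ImCM ReC_toC ImC_toC mul0r addr0 mulrC ImCD.
Qed.

End bernoulli.

(** * The Cauchy transform near infinity, across the real axis *)

Section cauchy_near_infinity.
Variables (R : realType) (mu : probability (measurableTypeR R) R).
Local Notation C := (Cplx R).
Local Notation G := (cauchy_transform mu).
Implicit Types z : C.

Lemma cauchy_cj z : ImC z != 0 -> G (cj z) = cj (G z).
Proof.
move=> z0; have [i1 i2] := Cintegrable_resolvent mu z0.
have E x : (cj z - toC x)^-1 = cj (z - toC x)^-1.
  by rewrite cjV cjD cjN cj_toC.
apply: CplxP; rewrite /cauchy_transform /Cintegral /=.
  by apply: eq_Rintegral => x _; exact: (congr1 (@ReC R) (E x)).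
transitivity (-1 * Rintegral mu setT (fun x => ImC (z - toC x)^-1)); last first.
  by rewrite mulN1r.
rewrite -RintegralZl//.
by apply: eq_Rintegral => x _; rewrite mulN1r; exact: (congr1 (@ImC R) (E x)).
Qed.

Lemma bounded_support_ae : bounded_support mu ->
  exists2 M : R, 0 < M & {ae mu, forall x, `|x| <= M}.
Proof.
(* The radius given by [bounded_support] may be zero or negative; [|M| + 1] is positive. *)
move=> [M HM]; exists (`|M| + 1); first by rewrite ltr_pwDr.
exists [set x | M < `|x|]; split => //.
  rewrite (_ : [set _ | _] = (fun x : measurableTypeR R => `|x|) @^-1` `]M, +oo[).
    have mn : measurable_fun setT (fun x : measurableTypeR R => `|x|).
      by apply: continuous_measurable_fun; exact: norm_continuous.
    rewrite -[X in measurable X]setTI; apply: mn => //.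
  by apply/seteqP; split => x /=; rewrite in_itv /= andbT.
move=> x /= /negP; rewrite -ltNge; apply: le_lt_trans.
by rewrite (le_trans (ler_norm _)) ?lerDl.
Qed.

Variable M : R.
Hypotheses (M0 : 0 < M) (ae_le_M : {ae mu, forall x, `|x| <= M}).

(** The ratio [k] is tuned to its use: 1 for integrability and the Lipschitz bound, 3 for
    injectivity. *)
Lemma resolvent_far k z x : 0 < k -> `|x| <= M -> (k + 1) * M <= nrm z ->
  z - toC x != 0 /\ nrm (z - toC x)^-1 <= (k * M)^-1.
Proof.
move=> k0 xM zM; have kM : 0 < k * M by rewrite mulr_gt0.
have H : k * M <= nrm (z - toC x).
  by apply: le_trans (nrm_triangle _ _); rewrite nrm_toC; lra.
have H0 := lt_le_trans kM H.
by split; [rewrite -nrm_gt0|rewrite nrmV lef_pV2 ?posrE].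
Qed.

Lemma Cintegrable_resolvent_far z : 2 * M <= nrm z ->
  Cintegrable mu (fun x => (z - toC x)^-1).
Proof.
move=> zM; apply: (@ae_bounded_Cintegrable _ _ _ (1 * M)^-1).
  exact: Cmeasurable_resolvent.
by apply: aeS ae_le_M => x xM; have [] := @resolvent_far 1 z x ltr01 xM zM.
Qed.

(** The resolvent identity, integrated. Since [z] and [w] may be real, it is used only for
    [|x| <= M], that is almost everywhere. *)
Lemma cauchy_diff_far z w : 2 * M <= nrm z -> 2 * M <= nrm w ->
  Cintegrable mu (fun x => (w - toC x)^-1 * (z - toC x)^-1) /\
  G w - G z = (z - w) * Cintegral mu (fun x => (w - toC x)^-1 * (z - toC x)^-1).
Proof.
move=> zM wM; have iz := Cintegrable_resolvent_far zM.
have iw := Cintegrable_resolvent_far wM.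
have H x : `|x| <= M -> nrm ((w - toC x)^-1 * (z - toC x)^-1) <= (M ^+ 2)^-1.
  move=> xM; rewrite nrmM expr2 invfM.
  have [_] := @resolvent_far 1 z x ltr01 xM zM.
  have [_] := @resolvent_far 1 w x ltr01 xM wM.
  by rewrite mul1r => h1 h2; rewrite ler_pM ?nrm_ge0.
have i2 : Cintegrable mu (fun x => (w - toC x)^-1 * (z - toC x)^-1).
  apply: (@ae_bounded_Cintegrable _ _ _ (M ^+ 2)^-1); last exact: aeS ae_le_M.
  by apply: CmeasurableM; exact: Cmeasurable_resolvent.
split=> //; rewrite -CintegralZ//.
have -> : G w - G z = Cintegral mu (fun x => (w - toC x)^-1 + (-1) * (z - toC x)^-1).
  rewrite CintegralD ?CintegralZ//; last exact: CintegrableZ.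
  by rewrite mulN1r.
apply: ae_eq_Cintegral; last apply: aeS ae_le_M => x xM.
- by apply: CintegrableD => //; exact: CintegrableZ.
- exact: CintegrableZ.
have [z0 _] := @resolvent_far 1 z x ltr01 xM zM.
have [w0 _] := @resolvent_far 1 w x ltr01 xM wM.
by field; rewrite z0 w0.
Qed.

Lemma cauchy_lip_far z w : 2 * M <= nrm z -> 2 * M <= nrm w ->
  nrm (G w - G z) <= nrm (z - w) / M ^+ 2.
Proof.
move=> zM wM; have [i2 ->] := cauchy_diff_far zM wM.
rewrite nrmM ler_wpM2l ?nrm_ge0//; apply: nrm_Cintegral => //.
apply: aeS ae_le_M => x xM; rewrite nrmM expr2 invfM.
have [_] := @resolvent_far 1 z x ltr01 xM zM.
have [_] := @resolvent_far 1 w x ltr01 xM wM.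
by rewrite mul1r => h1 h2; rewrite ler_pM ?nrm_ge0.
Qed.

(** By the resolvent identity it suffices that the mean of [w z / ((w - x) (z - x))] is nonzero.
    This integrand is [(1 + ew) (1 + ez)] with [ew] and [ez] of modulus at most 1/3, so its real
    part is at least [1 - 2/3 - 1/9 > 0]. *)
Lemma cauchy_inj_far z w : 4 * M <= nrm z -> 4 * M <= nrm w -> G z = G w -> z = w.
Proof.
move=> zM wM.
have z2 : 2 * M <= nrm z by have := M0; lra.
have w2 : 2 * M <= nrm w by have := M0; lra.
move=> E.
have [i2] := cauchy_diff_far z2 w2; rewrite E subrr => /esym/eqP.
rewrite mulf_eq0 subr_eq0 => /orP[/eqP//|/eqP J0].
have := @Cintegral_affine_gt0 _ mu _ 1 0 0 (CintegrableZ (w * z) i2).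
rewrite CintegralZ// J0 mulr0 !CE !mulr0 !addr0 ltxx => H.
suff: false by []; apply: H.
apply: aeS ae_le_M => x xM; rewrite mul1r mul0r !addr0.
have k : (0 : R) < 3 by lra.
have z4 : (3 + 1) * M <= nrm z by lra. have w4 : (3 + 1) * M <= nrm w by lra.
have [z0 nz] := @resolvent_far 3 z x k xM z4.
have [w0 nw] := @resolvent_far 3 w x k xM w4.
have -> : w * z * ((w - toC x)^-1 * (z - toC x)^-1) =
  1 + (toC x * (w - toC x)^-1 + toC x * (z - toC x)^-1 +
       (toC x * (w - toC x)^-1) * (toC x * (z - toC x)^-1)).
  by field; rewrite z0 w0.
have key v : nrm v <= (3 * M)^-1 -> nrm (toC x * v) <= 3^-1.
  move=> hv; rewrite nrmM nrm_toC.
  have -> : 3^-1 = M * (3 * M)^-1 :> R by field; rewrite gt_eqF.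
  by rewrite ler_pM ?nrm_ge0.
have e1 := key _ nz; have e2 := key _ nw.
set ez := toC x * (z - toC x)^-1 in e1 *; set ew := toC x * _ in e2 *.
have e3 : nrm (ew * ez) <= 3^-1 * 3^-1 by rewrite nrmM ler_pM ?nrm_ge0.
have f1 := le_trans (nrm_Re _) e1; have f2 := le_trans (nrm_Re _) e2.
have f3 := le_trans (nrm_Re _) e3.
rewrite ReCD ReC1 !ReCD; move: f1 f2 f3; rewrite !ler_norml; lra.
Qed.

End cauchy_near_infinity.

Section subordination.
Variables (R : realType) (a : R) (w : R -> probability (measurableTypeR R) R).
Local Notation C := (Cplx R).
Local Notation G := cauchy_transform.
Implicit Types (z o u : C) (t : R).
Hypothesis a0 : 0 < a.
Hypothesis fw : free_process w.
Hypothesis w0E : forall A : set R, measurable A -> w 0 A = sym_bernoulli a A.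

(** The Cauchy transform of the initial law as an explicit function, which can also be evaluated on
    the real axis away from the two atoms. *)
Definition bern o : C := o / (o ^+ 2 - toC a ^+ 2).

Lemma cj_bern o : cj (bern o) = bern (cj o).
Proof. by rewrite /bern cjM cjV cjD cjN !expr2 !cjM cj_toC. Qed.

Lemma bernN o : bern (- o) = - bern o.
Proof. by rewrite /bern sqrrN mulNr. Qed.

Lemma bern_neq0 o : ImC o != 0 ->
  [/\ o - toC a != 0, o + toC a != 0 & o ^+ 2 - toC a ^+ 2 != 0].
Proof.
move=> o0; have n1 := resolvent_neq0 a o0; have n2 := resolvent_neq0 (- a) o0.
by move: n2; rewrite toCN opprK => n2; rewrite subr_sqr mulf_neq0.
Qed.

Lemma bernE o : o - toC a != 0 -> o + toC a != 0 ->
  bern o = toC 2^-1 * ((o - toC a)^-1 + (o + toC a)^-1).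
Proof.
move=> h1 h2; have h3 : o ^+ 2 - toC a ^+ 2 != 0 by rewrite subr_sqr mulf_neq0.
by rewrite /bern toCV -natC; field; rewrite h3 h1 h2.
Qed.

Lemma ImCV_sqn z : z != 0 -> ImC z^-1 = - (ImC z * sqn z^-1).
Proof.
by move=> z0; rewrite -nrm_sq nrmV exprVn nrm_sq ImCV.
Qed.

(* Twice the integral of 1 / |o - x|^2 against the Bernoulli law. *)
Definition spread o : R := sqn (o - toC a)^-1 + sqn (o + toC a)^-1.

(** Each resolvent has imaginary part [- Im o] times its squared modulus. Hence, for [Im o > 0], the
    shifted point lies in the upper half-plane exactly when [t / 2 * spread o < 1]. *)
Lemma ImC_shift t o : ImC o != 0 ->
  ImC (o + toC t * bern o) = ImC o * (1 - t / 2 * spread o).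
Proof.
move=> o0; have [n1 n2 n3] := bern_neq0 o0; rewrite bernE// /spread.
rewrite ImCD ImCM ReC_toC ImC_toC mul0r addr0 ImCM ReC_toC ImC_toC mul0r addr0 ImCD.
rewrite !ImCV_sqn// !ImCD !ImCN ImC_toC oppr0 addr0; ring.
Qed.

Lemma spread_lt t o : 0 < ImC o -> 0 < ImC (o + toC t * bern o) ->
  t / 2 * spread o < 1.
Proof.
by move=> o0; rewrite ImC_shift ?gt_eqF// pmulr_rgt0// subr_gt0.
Qed.

(** The difference of the two sides is [(o1 - o2) (1 - t/2 P)], with [P] the sum of the products of
    corresponding resolvents. Then [Re P] is at most the average of the two spreads, and [t / 2]
    times each spread is below 1. *)
Lemma shift_inj t o1 o2 : 0 <= t -> 0 < ImC o1 -> 0 < ImC o2 ->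
  0 < ImC (o1 + toC t * bern o1) ->
  o1 + toC t * bern o1 = o2 + toC t * bern o2 -> o1 = o2.
Proof.
move=> t0 h1 h2 hz E; have := hz; rewrite E => hz2.
have s1 := spread_lt h1 hz; have s2 := spread_lt h2 hz2.
have [m1 m2 _] := bern_neq0 (lt0r_neq0 h1); have [n1 n2 _] := bern_neq0 (lt0r_neq0 h2).
set P := (o1 - toC a)^-1 * (o2 - toC a)^-1 + (o1 + toC a)^-1 * (o2 + toC a)^-1.
have : (o1 - o2) * (1 - toC (t / 2) * P) = 0.
  transitivity ((o1 + toC t * bern o1) - (o2 + toC t * bern o2)).
    by rewrite !bernE// /P !toCM !toCV -natC; field; rewrite m1 m2 n1 n2.
  by rewrite E subrr.
move=> /eqP; rewrite mulf_eq0 subr_eq0 => /orP[/eqP//|].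
suff H : 0 < ReC (1 - toC (t / 2) * P).
  by move=> /eqP E0; move: H; rewrite E0 ltxx.
rewrite ReCD ReCN ReCM ReC_toC ImC_toC mul0r subr0 ReC1 subr_gt0.
have aux (x y : C) : ReC (x * y) <= (sqn x + sqn y) / 2.
  rewrite ReCM /sqn; have := sqr_ge0 (ReC x - ReC y).
  by have := sqr_ge0 (ImC x + ImC y); rewrite !expr2; lra.
have hP : ReC P <= (spread o1 + spread o2) / 2.
  by rewrite /P ReCD /spread; have := aux (o1 - toC a)^-1 (o2 - toC a)^-1;
    have := aux (o1 + toC a)^-1 (o2 + toC a)^-1; lra.
have t2 : 0 <= t / 2 by rewrite divr_ge0.
by have := ler_wpM2l t2 hP; lra.
Qed.

Lemma subordination t z : 0 <= t -> 0 < ImC z ->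
  let u := G (w t) z in let o := z - toC t * u in
  [/\ ImC u < 0, 0 < ImC o, bern o = u & o + toC t * bern o = z].
Proof.
move=> t0 z0 u o; have u0 : ImC u < 0 by exact: ImC_cauchy_lt0.
have o0 : 0 < ImC o.
  by rewrite /o !CE mul0r addr0 subr_gt0 (le_lt_trans _ z0)// mulr_ge0_le0// ltW.
have E : bern o = u.
  rewrite /bern -(@cauchy_bernoulli _ _ (w 0)) ?gt_eqF//.
  by case: fw => _ wc wb; exact: backward_characteristic.
by split=> //; rewrite E /o subrK.
Qed.

(** Subordination at the shifted point produces some solution of the same equation; [shift_inj]
    identifies it with the given [o]. *)
Lemma cauchy_shift t o : 0 <= t -> 0 < ImC o -> 0 < ImC (o + toC t * bern o) ->
  G (w t) (o + toC t * bern o) = bern o.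
Proof.
move=> t0 o0 z0; have [u0 o'0 Eu Ez] := subordination t0 z0.
have := shift_inj t0 o'0 o0; rewrite Ez => /(_ z0 erefl) E.
by rewrite -Eu E.
Qed.

(** The threshold puts [o] at distance at least [1 + t] from both atoms, so both resolvents are at
    most [1 / (1 + t)], and [t / (1 + t) < 1] gives the last two claims. *)
Lemma spread_far t o : 0 <= t -> a + 1 + t <= nrm o ->
  [/\ o - toC a != 0, o + toC a != 0, t / 2 * spread o < 1 &
      nrm (toC t * bern o) <= 1].
Proof.
move=> t0 oM; have t1 : 0 < 1 + t by lra.
have h1 : 1 + t <= nrm (o - toC a).
  by apply: le_trans (nrm_triangle _ _); rewrite nrm_toC gtr0_norm//; lra.
have h2 : 1 + t <= nrm (o + toC a).
  rewrite -[toC a]opprK; apply: le_trans (nrm_triangle _ _).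
  by rewrite nrmN nrm_toC gtr0_norm//; lra.
have n1 : o - toC a != 0 by rewrite -nrm_gt0 (lt_le_trans t1).
have n2 : o + toC a != 0 by rewrite -nrm_gt0 (lt_le_trans t1).
have k1 : nrm (o - toC a)^-1 <= (1 + t)^-1 by rewrite nrmV lef_pV2 ?posrE ?nrm_gt0.
have k2 : nrm (o + toC a)^-1 <= (1 + t)^-1 by rewrite nrmV lef_pV2 ?posrE ?nrm_gt0.
have it : 0 < (1 + t)^-1 by rewrite invr_gt0.
have it1 : (1 + t) * (1 + t)^-1 = 1 by rewrite mulfV ?gt_eqF.
split => //.
  have q1 : sqn (o - toC a)^-1 <= (1 + t)^-1.
    by rewrite -nrm_sq expr2; have := ler_pM (nrm_ge0 _) (nrm_ge0 _) k1 k1; nra.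
  have q2 : sqn (o + toC a)^-1 <= (1 + t)^-1.
    by rewrite -nrm_sq expr2; have := ler_pM (nrm_ge0 _) (nrm_ge0 _) k2 k2; nra.
  by rewrite /spread; nra.
rewrite bernE// !nrmM !nrm_toC !ger0_norm ?invr_ge0//.
have := le_trans (nrmD _ _) (lerD k1 k2).
set n := nrm _ => hn; have := nrm_ge0 ((o - toC a)^-1 + (o + toC a)^-1); rewrite -/n.
by nra.
Qed.

Lemma cauchy_shift_nonreal t o : 0 <= t -> a + 1 + t <= nrm o -> ImC o != 0 ->
  G (w t) (o + toC t * bern o) = bern o.
Proof.
have pos o1 : 0 <= t -> a + 1 + t <= nrm o1 -> 0 < ImC o1 ->
    0 < ImC (o1 + toC t * bern o1).
  move=> t0 oM o0; have [n1 n2 sp _] := spread_far t0 oM.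
  by rewrite ImC_shift ?gt_eqF// mulr_gt0// subr_gt0.
move=> t0 oM; rewrite neq_lt => /orP[ho|ho]; last first.
  by apply: cauchy_shift => //; exact: pos.
have o0' : 0 < ImC (cj o) by rewrite /cj ImC_mk oppr_gt0.
have oM' : a + 1 + t <= nrm (cj o) by rewrite nrm_cj.
have := cauchy_shift t0 o0' (pos _ t0 oM' o0').
have H := pos _ t0 oM' o0'.
have E : cj o + toC t * bern (cj o) = cj (o + toC t * bern o).
  by rewrite cjD cjM cj_toC cj_bern.
rewrite E cauchy_cj; last first.
  by move: H; rewrite E /cj ImC_mk oppr_gt0 => /ltr0_neq0.
by rewrite -cj_bern => /(congr1 (@cj R)); rewrite !cjK.
Qed.

Lemma cauchy_shift_far t : 0 <= t -> exists2 rho : R, 0 < rho &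
  forall o, rho <= nrm o -> G (w t) (o + toC t * bern o) = bern o.
Proof.
move=> t0; have [bs _ _] := fw; have [M M0 aeM] := bounded_support_ae (bs t t0).
(* [a + 1 + t] is the threshold of [spread_far]; the rest keeps the shifted point, displaced by at
   most 1, at modulus at least [2 * M], where [G (w t)] is Lipschitz. *)
have ha := a0; exists (a + 1 + t + 2 * M + 2); first lra.
move=> o oM; have [ho|] := eqVneq (ImC o) 0; last first.
  by apply: cauchy_shift_nonreal => //; lra.
(* A real [o] is approached vertically through nonreal points, where the identity is known; both
   sides are continuous there. *)
pose q (h : R) : C := o + toC h * mkC 0 1.
have qo : q h @[h --> 0^'+] --> o.
  rewrite -[X in _ --> X]addr0 -[X in _ --> o + X](mul0r (mkC 0 1)) -toC0.
  apply: cvgD; first exact: cvg_cst.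
  apply: cvgM; last exact: cvg_cst.
  by apply: cvg_toC; apply: cvg_at_right_filter; exact: cvg_id.
have oM' : a + 1 + t <= nrm o by lra.
have [n1 n2 _ ts] := spread_far t0 oM'.
have bq : bern (q h) @[h --> 0^'+] --> bern o.
  apply: cvgM; first exact: qo.
  apply: cvgV; first by rewrite subr_sqr mulf_neq0.
  have q2 : q h ^+ 2 @[h --> 0^'+] --> o ^+ 2 by exact: (cvgM qo qo).
  exact: (cvgB q2 (cvg_cst (toC a ^+ 2))).
have cq : (q h + toC t * bern (q h)) @[h --> 0^'+] --> o + toC t * bern o.
  apply: cvgD; first exact: qo.
  by apply: cvgM; [exact: cvg_cst|exact: bq].
have nq h : 0 < h -> a + 1 + t + 2 * M + 2 <= nrm (q h) /\ ImC (q h) != 0.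
  move=> h0; rewrite /q; split; last by rewrite !CE ho; lra.
  apply: le_trans oM _; rewrite /nrm ler_sqrt ?sqn_ge0// /sqn !CE ho; nra.
have far o1 : a + 1 + t + 2 * M + 2 <= nrm o1 ->
    2 * M <= nrm (o1 + toC t * bern o1).
  move=> h1; have h1' : a + 1 + t <= nrm o1 by lra.
  have [_ _ _ h2] := spread_far t0 h1'.
  rewrite -[toC t * _]opprK; apply: le_trans (nrm_triangle _ _).
  by rewrite nrmN; lra.
have Gq : G (w t) (q h + toC t * bern (q h)) @[h --> 0^'+] -->
    G (w t) (o + toC t * bern o).
  apply: cvgC_nrm => e e0.
  have /(cvgC_nrmP cq) : 0 < e * M ^+ 2 by rewrite mulr_gt0 ?exprn_gt0.
  move=> H; near=> h.
  have hh : 0 < h by near: h; exact: nbhs_right_gt.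
  have [h1 _] := nq _ hh.
  have h2 : nrm (o + toC t * bern o - (q h + toC t * bern (q h))) < e * M ^+ 2.
    by near: h.
  apply: le_lt_trans (cauchy_lip_far M0 aeM (far _ h1) (far _ oM)) _.
  by rewrite ltr_pdivrMr ?exprn_gt0// -nrmN opprB.
have H : bern (q h) @[h --> 0^'+] --> G (w t) (o + toC t * bern o).
  apply: cvg_trans Gq; apply: near_eq_cvg; near=> h.
  have hh : 0 < h by near: h; exact: nbhs_right_gt.
  have [h1 h2] := nq _ hh; apply: cauchy_shift_nonreal => //.
  by move: h1; lra.
by rewrite -(cvg_lim (@norm_hausdorff _ _) H) (cvg_lim (@norm_hausdorff _ _) bq).
Unshelve. all: by end_near. Qed.

End subordination.

(** * The R-transform *)

Section R_transform_formula.
Variables (R : realType) (a : R) (w : R -> probability (measurableTypeR R) R).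
Local Notation C := (Cplx R).
Local Notation G := cauchy_transform.
Implicit Types (z o u : C) (t : R).
Hypothesis a0 : 0 < a.
Hypothesis fw : free_process w.
Hypothesis w0E : forall A : set R, measurable A -> w 0 A = sym_bernoulli a A.

Let disc z : C := 1 + 4 * toC a ^+ 2 * z ^+ 2.

(** The root of [z o^2 - o - a^2 z = 0] that behaves like [1 / z] at 0; the other root tends to
    0. *)
Definition bern_inverse z : C := (1 + csqrt (disc z)) / (2 * z).

Lemma disc_gt0 z : 4 * a * nrm z <= 1 -> 0 < ReC (disc z).
Proof.
move=> zs; rewrite /disc ReCD ReC1.
have h1 : nrm (4 * toC a ^+ 2 * z ^+ 2) <= 4^-1.
  have p : 0 <= 4 * a ^+ 2 by rewrite mulr_ge0// sqr_ge0.
  rewrite natC -toCX -toCM nrmM nrm_toC (ger0_norm p).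
  rewrite expr2 nrmM -expr2.
  have : (4 * a * nrm z) ^+ 2 <= 1.
    by rewrite expr_le1// !mulr_ge0 ?nrm_ge0// ltW.
  rewrite !exprMn; set x := a ^+ 2; set y := nrm z ^+ 2 => h.
  have -> : 4 * x * y = 4^-1 * (4 ^+ 2 * x * y) by field.
  by rewrite ler_piMr.
have := le_trans (nrm_Re _) h1; rewrite ler_norml => /andP[h _].
by rewrite -ltrBlDl sub0r (lt_le_trans _ h)// ltrN2 invf_lt1 ?ltr1n.
Qed.

(** The lower bound comes from [Re (1 + r) >= 1]; it drives [bern_inverse z] to infinity as [z]
    tends to 0, into the region of [cauchy_shift_far]. *)
Lemma bern_inverseP z : z != 0 -> 4 * a * nrm z <= 1 ->
  bern a (bern_inverse z) = z /\ (2 * nrm z)^-1 <= nrm (bern_inverse z).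
Proof.
move=> z0 zs; have r0 := disc_gt0 zs; have s0 := csqrt_gt0 r0.
have sE := sqr_csqrt (disc z).
set r := csqrt (disc z) in s0 sE.
have two0 : (2 : C) != 0 by rewrite natC toC_eq0 pnatr_eq0.
have r1 : 1 + r != 0.
  by apply: neq0_Re; rewrite ReCD ReC1 gt_eqF// addr_gt0.
split.
  have E : bern_inverse z ^+ 2 - toC a ^+ 2 = (1 + r) / (2 * z ^+ 2).
    have -> : toC a ^+ 2 = (r ^+ 2 - 1) / (4 * z ^+ 2).
      by rewrite sE /disc; field; rewrite ?z0 ?two0.
    by rewrite /bern_inverse -/r; field; rewrite ?z0 ?two0.
  by rewrite /bern E /bern_inverse -/r; field; rewrite ?r1 ?z0 ?two0.
rewrite /bern_inverse -/r nrmM nrmV [nrm (2 * z)]nrmM natC nrm_toC ger0_norm//.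
rewrite ler_peMl ?invr_ge0 ?mulr_ge0 ?nrm_ge0//.
by apply: le_trans (le_trans (ler_norm _) (nrm_Re _)); rewrite ReCD ReC1 lerDl ltW.
Qed.

Lemma R_transform_formula t : 0 <= t ->
  exists (U : set C) (r : C -> C),
    [/\ nbhs (0 : C) U,
        sqrt_branch U (fun z => 1 + 4 * toC a ^+ 2 * z ^+ 2) r,
        r 0 = 1 &
        forall z, U z -> z != 0 ->
          R_transform (w t) z = 2^-1 * (2 * toC t * z ^+ 2 - 1 + r z)].
Proof.
move=> t0; have [rho rho0 far] := cauchy_shift_far a0 fw w0E t0.
have [bs _ _] := fw; have [M M0 aeM] := bounded_support_ae (bs t t0).
pose K z := bern_inverse z + toC t * z.
have small N : exists2 e : R, 0 < e & forall z, z != 0 -> nrm z < e ->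
    [/\ 4 * a * nrm z <= 1, G (w t) (K z) = z & N < nrm (K z)].
  (* A modulus [L] for [bern_inverse z] exceeds [rho], and still exceeds [N] after losing [|t z|],
     which is at most [t] because [|z| < 1]. *)
  pose L := `|N| + rho + t + 1; have L0 : 0 < L.
    by rewrite /L; have := normr_ge0 N; lra.
  exists (Num.min 1 (Num.min (4 * a)^-1 (2 * L)^-1)).
    by rewrite !lt_min ltr01 !invr_gt0 !mulr_gt0.
  move=> z z0; rewrite !lt_min => /andP[z1 /andP[z2 z3]].
  have zs : 4 * a * nrm z <= 1.
    rewrite mulrC; move/ltW: z2; rewrite -[_^-1]mul1r ler_pdivlMr// mulr_gt0//.
  have [E big] := bern_inverseP z0 zs.
  have zp : 0 < nrm z by rewrite nrm_gt0.
  have bigL : L <= nrm (bern_inverse z).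
    apply: le_trans big; rewrite -(invrK L) lef_pV2 ?posrE ?invr_gt0 ?mulr_gt0//.
    by move: z3; rewrite invfM; lra.
  split => //.
    have := far (bern_inverse z); rewrite E => -> //; apply: le_trans bigL.
    by rewrite /L; have := normr_ge0 N; lra.
  have : nrm (bern_inverse z) - nrm (toC t * z) <= nrm (K z).
    rewrite /K -[toC t * z in X in _ <= X]opprK -(nrmN (toC t * z)).
    exact: nrm_triangle.
  rewrite nrmM nrm_toC ger0_norm//.
  have : t * nrm z <= t by rewrite ler_piMr// ltW.
  by move: bigL; rewrite /L; have := ler_norm N; lra.
(* [cauchy_inverse] is a choice, so some inverse must be exhibited. [K1] picks a preimage of modulus
   above [4 * M]: injectivity there makes it a left inverse, and [K] shows that such a preimage
   exists near 0. *)
have H : inverse_near_infinity (G (w t)) (cauchy_inverse (w t)).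
  rewrite /cauchy_inverse; apply: xgetPex.
  pose K1 u := xget (0 : C) [set z | 4 * M < nrm z /\ G (w t) z = u].
  exists K1; split.
    exists (4 * M) => z; rewrite nrm_norm => zM.
    have : [set z' | 4 * M < nrm z' /\ G (w t) z' = G (w t) z] (K1 (G (w t) z)).
      by apply: xgetPex; exists z.
    by move=> [/ltW h E]; apply: (cauchy_inj_far M0 aeM h (ltW zM) E).
  have [e e0 He] := small (4 * M).
  near=> u.
  have u0 : u != 0 by near: u; exact: nbhs_dnbhs_neq.
  have ue : nrm u < e by near: u; apply: nbhs_dnbhs; exact: near0_nrm.
  have [_ h1 h2] := He _ u0 ue.
  have : [set z | 4 * M < nrm z /\ G (w t) z = u] (K1 u).
    by apply: xgetPex; exists (K u).
  by case.
(* The chosen inverse undoes [G (w t)] only beyond some [N]; near 0 the point [K z] lies beyond [N]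
   and is sent to [z], so the chosen inverse takes the value [K z] at [z]. *)
have [[N HN] _] := H; have [e e0 He] := small N.
exists [set z | nrm z < Num.min e (4 * a)^-1], (fun z => csqrt (disc z)); split.
- apply: near0_nrm; rewrite lt_min e0 invr_gt0 mulr_gt0//.
- move=> z /=; rewrite lt_min => /andP[_ z2].
  have zs : 4 * a * nrm z <= 1.
    by rewrite mulrC; move/ltW: z2; rewrite -[_^-1]mul1r ler_pdivlMr// mulr_gt0.
  split; last exact: sqr_csqrt.
  apply: derivable_csqrt_comp; last exact: disc_gt0.
  apply: holoD; first exact: holo_cst.
  apply: holoM; first exact: holo_cst.
  exact/holo_sqr/holo_id.
- by rewrite /disc expr0n mulr0 addr0 csqrt1.
move=> z /=; rewrite lt_min => /andP[ze _] z0.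
have [zs h1 h2] := He _ z0 ze.
rewrite /R_transform -{2}h1 HN ?nrm_norm// /K /bern_inverse.
have two0 : (2 : C) != 0 by rewrite natC toC_eq0 pnatr_eq0.
by field; rewrite ?z0 ?two0.
Unshelve. all: by end_near. Qed.

End R_transform_formula.

(** * The S-transforms *)

Section cones.
Variable R : realType.
Local Notation C := (Cplx R).
Implicit Types z w : C.

Lemma upper_coneP z : upper_cone z <-> `|ReC z| < ImC z.
Proof.
rewrite /upper_cone /=; split => [[z0]|h]; first by rewrite (gtr0_norm z0).
by have z0 : 0 < ImC z := le_lt_trans (normr_ge0 _) h; rewrite (gtr0_norm z0).
Qed.

Lemma lower_coneP z : lower_cone z <-> `|ReC z| < - ImC z.
Proof.
rewrite /lower_cone /=; split => [[z0]|h]; first by rewrite (ltr0_norm z0).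
have : 0 < - ImC z := le_lt_trans (normr_ge0 _) h.
by rewrite oppr_gt0 => z0; rewrite (ltr0_norm z0).
Qed.

Lemma lower_coneN z : lower_cone (- z) <-> upper_cone z.
Proof. by rewrite lower_coneP upper_coneP ReCN ImCN normrN opprK. Qed.

Lemma upper_coneD z w : upper_cone z -> upper_cone w -> upper_cone (z + w).
Proof.
move=> /upper_coneP h1 /upper_coneP h2; apply/upper_coneP; rewrite !CE.
exact: le_lt_trans (ler_normD _ _) (ltrD h1 h2).
Qed.

Lemma lower_coneV z : lower_cone z^-1 <-> upper_cone z.
Proof.
rewrite lower_coneP upper_coneP ReCV ImCV opprK -/(sqn z).
have [->|z0] := eqVneq z 0; first by rewrite !CE !mul0r normr0.
have s0 := sqn_gt0 z0; rewrite normrM normfV (gtr0_norm s0).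
by rewrite ltr_pM2r ?invr_gt0.
Qed.

Lemma upper_coneV z : upper_cone z^-1 <-> lower_cone z.
Proof. by rewrite -{2}[z]invrK lower_coneV. Qed.

Lemma cone_sqr z : `|ReC z| < `|ImC z| <-> ReC (z ^+ 2) < 0.
Proof.
rewrite -ltr_sqr ?nnegrE ?normr_ge0// !real_normK ?num_real// !CE subr_lt0.
by [].
Qed.

Lemma Re_mul_gt0 z w : `|ImC z| < ReC z -> `|ImC w| < ReC w -> 0 < ReC (z * w).
Proof.
move=> hz hw; rewrite ReCM subr_gt0; apply: le_lt_trans (ler_norm _) _.
by rewrite normrM ltr_pM.
Qed.

Lemma right_coneV z : `|ImC z| < ReC z -> `|ImC z^-1| < ReC z^-1.
Proof.
move=> h; have z0 : z != 0 by rewrite neq0_Re// gt_eqF// (le_lt_trans _ h).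
rewrite ReCV ImCV -/(sqn z) normrN normrM normfV (gtr0_norm (sqn_gt0 z0)).
by rewrite ltr_pM2r// invr_gt0 sqn_gt0.
Qed.

End cones.

(** * Symmetry of the law at time t, and the disc containing the values of Psi *)

Section S_transform_domain.
Variables (R : realType) (a : R) (w : R -> probability (measurableTypeR R) R).
Local Notation C := (Cplx R).
Local Notation G := cauchy_transform.
Implicit Types (z o u p y : C) (t : R).
Hypothesis a0 : 0 < a.
Hypothesis fw : free_process w.
Hypothesis w0E : forall A : set R, measurable A -> w 0 A = sym_bernoulli a A.

(** The reflection sending [o] to [- cj o] preserves the upper half-plane and the equation
    [p = o + t G_0(o)], because [G_0] is odd and commutes with conjugation. So oddness passes from
    time 0 to time [t]. *)
Lemma cauchy_odd t p : 0 <= t -> 0 < ImC p -> G (w t) (- p) = - G (w t) p.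
Proof.
move=> t0 p0; have [u0 o0 Eu Ep] := subordination a0 fw w0E t0 p0.
set u := G (w t) p in u0 o0 Eu Ep *; set o := p - toC t * u in o0 Eu Ep *; clearbody o.
have Eo : bern a (- cj o) = - cj u.
  by rewrite bernN -cj_bern Eu.
have Ep' : - cj o + toC t * bern a (- cj o) = - cj p.
  rewrite Eo -[in RHS]Ep Eu cjD cjM cj_toC. ring.
have o0' : 0 < ImC (- cj o) by rewrite /cj !CE opprK.
have p0' : 0 < ImC (- cj o + toC t * bern a (- cj o)).
  by rewrite Ep' /cj !CE opprK.
have := cauchy_shift a0 fw w0E t0 o0' p0'; rewrite Ep' Eo => E.
have -> : - p = cj (- cj p) by rewrite cjN cjK.
by rewrite cauchy_cj ?E ?cjN ?cjK// /cj !CE opprK gt_eqF.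
Qed.

Lemma Psi_cauchy (mu : probability (measurableTypeR R) R) z : ImC z != 0 ->
  Psi mu z = z^-1 * G mu z^-1 - 1.
Proof.
move=> z0; have zn := neq0_Im z0.
have p0 : ImC z^-1 != 0.
  by rewrite ImCV oppr_eq0 mulf_neq0// invr_neq0// gt_eqF// sqn_gt0.
have ip := Cintegrable_resolvent mu p0.
rewrite /Psi.
have -> : (fun x => toC x * z / (1 - toC x * z)) =
          (fun x => z^-1 * (z^-1 - toC x)^-1 + (-1)).
  apply/funext => x; have px := resolvent_neq0 x p0.
  have h : 1 - toC x * z = z * (z^-1 - toC x) by field.
  have h0 : 1 - toC x * z != 0 by rewrite h mulf_neq0.
  rewrite h; set d := z^-1 - toC x in px *.
  have hx : toC x = z^-1 - d by rewrite /d; ring.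
  by rewrite hx; field; rewrite px zn.
by rewrite CintegralD ?Cintegral_cst ?CintegralZ//;
  [exact: CintegrableZ|exact: Cintegrable_cst].
Qed.

Lemma Psi_even t z : 0 <= t -> 0 < ImC z -> Psi (w t) (- z) = Psi (w t) z.
Proof.
move=> t0 z0.
have q0 : 0 < ImC (- z)^-1.
  have zn : z != 0 by rewrite neq0_Im ?gt_eqF.
  by rewrite invrN ImCN ImCV_sqn// opprK mulr_gt0// sqn_gt0// invr_neq0.
rewrite !Psi_cauchy ?ImCN ?oppr_eq0 ?gt_eqF//.
have -> : z^-1 = - (- z)^-1 by rewrite invrN opprK.
by rewrite cauchy_odd// mulrNN.
Qed.

(** The integrand is [p / (p^2 - x^2)], the average of the resolvents at [x] and [- x]. For [p] in
    the upper cone it stays in the lower cone, which a single resolvent need not do. *)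
Lemma cauchy_symmetric t p : 0 <= t -> 0 < ImC p ->
  Cintegrable (w t) (fun x => (p - toC (x ^+ 2) / p)^-1) /\
  G (w t) p = Cintegral (w t) (fun x => (p - toC (x ^+ 2) / p)^-1).
Proof.
move=> t0 p0; have pn : p != 0 by rewrite neq0_Im ?gt_eqF.
have i1 := Cintegrable_resolvent (w t) (lt0r_neq0 p0).
have Np0 : ImC (- p) != 0 by rewrite ImCN oppr_eq0 gt_eqF.
have i2 := Cintegrable_resolvent (w t) Np0.
have E : (fun x => (p - toC (x ^+ 2) / p)^-1) =
   (fun x => toC 2^-1 * ((p - toC x)^-1 + (-1) * (- p - toC x)^-1)).
  apply/funext => x; have h1 := resolvent_neq0 x (lt0r_neq0 p0).
  have h2 := resolvent_neq0 x Np0.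
  have h3 : p - toC (x ^+ 2) / p = - (p - toC x) * (- p - toC x) / p.
    by rewrite toCX; field.
  rewrite h3 toCV -natC.
  have h : p = 2^-1 * ((p - toC x) - (- p - toC x)) by field.
  move: h1 h2 h; move: (p - toC x) (- p - toC x) => d1 d2 h1 h2 h.
  have hn : d1 - d2 != 0 by apply: contraNneq pn => d12; rewrite h d12 mulr0.
  by rewrite h; field; rewrite ?h1 ?h2 ?hn.
have i3 := CintegrableZ (-1) i2.
have i4 := CintegrableD i1 i3.
rewrite E; split; first exact: CintegrableZ.
rewrite CintegralZ// CintegralD// CintegralZ//.
rewrite -/(G (w t) p) -/(G (w t) (- p)) cauchy_odd// toCV -natC.
by field.
Qed.

(** Both [p] and, for [x] nonzero, [- x^2 / p] lie in the upper cone, which is stable under sums and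
    sent to the lower cone by inversion. The mean stays in the lower cone, an intersection of two
    half-planes. *)
Lemma cauchy_lower_cone t p : 0 <= t -> upper_cone p -> lower_cone (G (w t) p).
Proof.
move=> t0 hp; have [p0 _] := hp; have [ip ->] := cauchy_symmetric t0 p0.
have key x : lower_cone (p - toC (x ^+ 2) / p)^-1.
  apply/lower_coneV; have [->|x0] := eqVneq x 0.
    by rewrite expr0n toC0 mul0r subr0.
  apply: upper_coneD => //; apply/lower_coneN; rewrite opprK.
  have /lower_coneP h : lower_cone p^-1 by apply/lower_coneV.
  apply/lower_coneP; rewrite !CE !mul0r subr0 addr0 -mulrN normrM.
  by rewrite (@gtr0_norm _ (x * x)) ?ltr_pM2l// -expr2 exprn_even_gt0.
apply/lower_coneP; rewrite ltr_norml; apply/andP; split.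
  have := @Cintegral_affine_gt0 _ _ _ 1 (-1) 0 ip; rewrite !mul1r !mulN1r !addr0 => H.
  rewrite opprK -subr_gt0; apply: H; apply: aeE => x.
  by have /lower_coneP := key x; rewrite ltr_norml mul1r mulN1r addr0 => /andP[]; lra.
have := @Cintegral_affine_gt0 _ _ _ (-1) (-1) 0 ip; rewrite !mulN1r !addr0 => H.
rewrite -subr_gt0 addrC; apply: H; apply: aeE => x.
by have /lower_coneP := key x; rewrite ltr_norml !mulN1r addr0 => /andP[]; lra.
Qed.

(** Equality would force [t o = - a^2 p], whose two sides have imaginary parts of incompatible
    signs. This supplies the strict inequality in [cauchy_half_disc] at [x = 0]. *)
Lemma mul_cauchy_neq1 t p : 0 <= t -> 0 < ImC p -> p * G (w t) p != 1.
Proof.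
move=> t0 p0; have [u0 o0 Eu Ep] := subordination a0 fw w0E t0 p0.
set u := G (w t) p in u0 o0 Eu Ep *; set o := p - toC t * u in o0 Eu Ep *; clearbody o.
apply/eqP => pu; have [_ _ d0] := bern_neq0 a (lt0r_neq0 o0).
have on : o != 0 by rewrite neq0_Im ?gt_eqF.
have E1 : o * u = 1 + toC a ^+ 2 / (o ^+ 2 - toC a ^+ 2).
  by rewrite -Eu /bern; field.
have E2 : (o + toC t * u) * u = 1 by rewrite -{1}Eu Ep.
have E3 : toC t * o = - toC a ^+ 2 * p.
  have : toC t * u * u + toC a ^+ 2 / (o ^+ 2 - toC a ^+ 2) = 0.
    by move: E2; rewrite mulrDl E1 => /eqP; rewrite -subr_eq0 => /eqP <-; ring.
  have -> : (o ^+ 2 - toC a ^+ 2)^-1 = u / o by rewrite -Eu /bern; field; rewrite on d0.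
  have un : u != 0 by rewrite neq0_Im ?lt_eqF.
  move=> H.
  have : u * (toC t * u + toC a ^+ 2 / o) = 0 by rewrite -[RHS]H; ring.
  move=> /eqP; rewrite mulf_eq0 (negbTE un) /= => /eqP H2.
  have H3 : toC t * u * o = - toC a ^+ 2.
    apply/eqP; rewrite -subr_eq0 opprK; apply/eqP.
    by rewrite -[RHS](mul0r o) -H2; field.
  by rewrite -H3 -[LHS]mulr1 -pu; ring.
have := congr1 (@ImC R) E3; rewrite -toCX -toCN !ImCM !ReC_toC !ImC_toC !mul0r !addr0.
have : 0 <= t * ImC o by rewrite mulr_ge0// ltW.
have : 0 < a ^+ 2 * ImC p by rewrite mulr_gt0 ?exprn_gt0.
by rewrite mulNr; lra.
Qed.

(** The disc [|y + 1/2| < 1/2], written so that [Re ((1 + y) / y) = 1 + Re y / |y|^2 < 0] is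
    immediate. *)
Definition half_disc y : Prop := ReC y + sqn y < 0.

Lemma half_discP y : half_disc y -> [/\ -1 < ReC y, ReC y < 0 & y != 0].
Proof.
rewrite /half_disc /sqn => h; have := sqr_ge0 (ImC y).
have y0 : ReC y < 0 by have := sqr_ge0 (ImC y); have := sqr_ge0 (ReC y); lra.
by split=> //; [rewrite expr2 in h; nra|rewrite neq0_Re// lt_eqF].
Qed.

Lemma half_disc_ratio y : half_disc y -> ReC ((1 + y) / y) < 0.
Proof.
move=> hy; have [h1 h2 h3] := half_discP hy.
rewrite mulrDl mul1r mulfV// ReCD ReC1 ReCV -/(sqn y).
by rewrite -ltrBrDr sub0r ltr_pdivrMr ?sqn_gt0// mulN1r ltrNr -subr_lt0 opprK addrC.
Qed.

Lemma cauchy_half_disc t p : 0 <= t -> upper_cone p ->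
  half_disc (p * G (w t) p - 1).
Proof.
move=> t0 hp; have [p0 p1] := hp; have [ip E] := cauchy_symmetric t0 p0.
have pn : p != 0 by rewrite neq0_Im ?gt_eqF.
have Q1 := mul_cauchy_neq1 t0 p0; set Q := p * G (w t) p in Q1 *.
have iq := CintegrableZ p ip.
have EQ : Cintegral (w t) (fun x => p * (p - toC (x ^+ 2) / p)^-1) = Q.
  by rewrite CintegralZ// -E.
(* These are the coefficients of [Re q - |q|^2 + |q - Q|^2], which is affine in [q] because the
   squares cancel; its value at [Q] is [Re Q - |Q|^2]. *)
have := @Cintegral_affine_gt0 _ _ _ (1 - 2 * ReC Q) (- 2 * ImC Q) (sqn Q) iq.
rewrite EQ => H.
suff : 0 < (1 - 2 * ReC Q) * ReC Q + (-2 * ImC Q) * ImC Q + sqn Q.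
  by rewrite /half_disc /sqn !CE; lra.
apply: H; apply: aeE => x; set q := p * _.
(* Re Q - |Q|^2 is the mean of Re q - |q|^2 + |q - Q|^2, whose first part is
   nonnegative and vanishes only at x = 0, where q = 1 differs from Q. *)
suff : 0 < ReC q - sqn q + sqn (q - Q) by rewrite /sqn !CE; lra.
have [x0|x0] := eqVneq x 0.
  have -> : q = 1 by rewrite /q x0 expr0n toC0 mul0r subr0 mulfV.
  rewrite ReC1 /sqn ReC1 ImC1 expr1n expr0n addr0 subrr add0r.
  by apply: sqn_gt0; rewrite subr_eq0 eq_sym.
have /lower_coneP ic : lower_cone p^-1 by apply/lower_coneV.
have ic2 : ReC (p^-1 ^+ 2) < 0.
  by apply/cone_sqr; apply: lt_le_trans ic _; rewrite -normrN ler_norm.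
have s0 : 0 < - ReC (toC (x ^+ 2) * p^-1 ^+ 2).
  rewrite ReCM ReC_toC ImC_toC mul0r subr0 oppr_gt0 pmulr_rlt0//.
  by rewrite exprn_even_gt0.
have d1 : 0 < ReC (1 - toC (x ^+ 2) * p^-1 ^+ 2) by rewrite ReCD ReC1 ReCN; lra.
have dn : 1 - toC (x ^+ 2) * p^-1 ^+ 2 != 0 by rewrite neq0_Re ?gt_eqF.
have qE : q = (1 - toC (x ^+ 2) * p^-1 ^+ 2)^-1.
  have E1 : p - toC (x ^+ 2) / p = p * (1 - toC (x ^+ 2) * p^-1 ^+ 2) by field.
  by rewrite /q E1 invfM mulrA mulfV ?mul1r.
have qn : q != 0 by rewrite qE invr_neq0.
(* Here [1/q = 1 - x^2 / p^2] has real part above 1, because [p^-1] lies in a cone where squares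
   have negative real part; hence [Re q > |q|^2]. *)
have : ReC q = ReC q^-1 * sqn q.
  by rewrite ReCV -/(sqn q) divfK// gt_eqF// sqn_gt0.
rewrite [in ReC q^-1]qE invrK ReCD ReC1 ReCN.
have := sqn_ge0 (q - Q); have := sqn_gt0 qn; nra.
Qed.

End S_transform_domain.

(** * Explicit branches for the S-transform *)

Section S_transform_branches.
Variables (R : realType) (a : R).
Local Notation C := (Cplx R).
Implicit Types (z y : C) (t : R).
Hypothesis a0 : 0 < a.

(* With c = 1 / (o^2 - a^2), the quadratic equation y = c (a^2 + t + t a^2 c) gives
   S_m = a^2 + t + t a^2 c and S_B = t u^2 / y. *)
Definition S_kappa t : R := 4 * a ^+ 2 * t / (a ^+ 2 + t) ^+ 2.
Definition S_r t y : C := csqrt (1 + toC (S_kappa t) * y).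
Definition S_m t y : C := toC ((a ^+ 2 + t) / 2) * (1 + S_r t y).
Definition S_B t y : C := 1 - toC (a ^+ 2) / S_m t y.
Definition S_b t y : C := csqrt (S_B t y).
(** The branch of [(t y)^(1/2)] belonging to the lower cone. The sign is taken out of the root
    because [Re y < 0] on the disc. *)
Definition S_s t y : C := - mkC 0 1 * csqrt (- (toC t * y)).

Let a2 : 0 < a ^+ 2. Proof. by rewrite exprn_gt0. Qed.

Lemma sqr_I : mkC 0 1 * mkC 0 1 = -1 :> C.
Proof. by apply: CplxP; rewrite !CE; ring. Qed.

Lemma toC_S_kappa t :
  toC (S_kappa t) = 4 * toC a ^+ 2 * toC t / (toC a ^+ 2 + toC t) ^+ 2 :> C.
Proof.
rewrite /S_kappa [LHS]toCM toCV [in (toC _)^-1]toCX toCD.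
by rewrite [toC (_ * t)]toCM [toC (4 * _)]toCM !toCX -natC.
Qed.

(** With [rho = (a^2 - t) / (a^2 + t)] this gives [kappa <= 1], and for [Re y > -1] and [t > 0] it
    makes the real part of [1 + kappa y] exceed [rho^2]. *)
Lemma S_kappaE t : 0 <= t -> S_kappa t = 1 - ((a ^+ 2 - t) / (a ^+ 2 + t)) ^+ 2.
Proof.
move=> t0; have n0 : a ^+ 2 + t != 0 by rewrite gt_eqF// ltr_pwDl.
by rewrite /S_kappa; field.
Qed.

Lemma Re_S_r_arg t y : 0 <= t -> -1 < ReC y ->
  0 < ReC (1 + toC (S_kappa t) * y).
Proof.
move=> t0 y1; have At : 0 < a ^+ 2 + t by rewrite ltr_pwDl.
rewrite ReCD ReC1 ReCM ReC_toC ImC_toC mul0r subr0.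
have k0 : 0 <= S_kappa t.
  by apply: divr_ge0; [rewrite !mulr_ge0// ltW|rewrite exprn_ge0// ltW].
have k1 : S_kappa t <= 1 by rewrite S_kappaE// gerBl sqr_ge0.
by have [k00|kp] := eqVneq (S_kappa t) 0;
  [rewrite k00 mul0r addr0 ltr01|have : 0 < S_kappa t by [rewrite lt_def kp]; nra].
Qed.

Lemma Re_S_r_arg_gt t y : 0 < t -> -1 < ReC y ->
  ((a ^+ 2 - t) / (a ^+ 2 + t)) ^+ 2 < ReC (1 + toC (S_kappa t) * y).
Proof.
move=> t0 y1; have At : 0 < a ^+ 2 + t by rewrite addr_gt0.
rewrite ReCD ReC1 ReCM ReC_toC ImC_toC mul0r subr0.
have k0 : 0 < S_kappa t by rewrite divr_gt0 ?mulr_gt0 ?exprn_gt0.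
by have := S_kappaE (ltW t0); set rho := _ ^+ 2; nra.
Qed.

Lemma S_r_gt0 t y : 0 <= t -> -1 < ReC y -> 0 < ReC (S_r t y).
Proof. by move=> t0 y1; apply/csqrt_gt0/Re_S_r_arg. Qed.

Lemma S_m_gt0 t y : 0 <= t -> -1 < ReC y -> 0 < ReC (S_m t y).
Proof.
move=> t0 y1; rewrite /S_m ReCM ReC_toC ImC_toC mul0r subr0 ReCD ReC1.
by apply: mulr_gt0; [rewrite divr_gt0// ltr_pwDl|rewrite addr_gt0// S_r_gt0].
Qed.

Lemma S_m_neq0 t y : 0 <= t -> -1 < ReC y -> S_m t y != 0.
Proof. by move=> t0 y1; rewrite neq0_Re ?gt_eqF ?S_m_gt0. Qed.

(** With [A = (a^2 + t) / 2] one has [a^2 = A (1 + rho)] and [m = A (1 + r)], so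
    [S_B = 1 - (1 + rho) / (1 + r)]. It suffices that [Re r > rho], which follows from
    [(Re r)^2 >= Re (r^2) > rho^2]. *)
Lemma Re_S_B t y : 0 < t -> -1 < ReC y -> 0 < ReC (S_B t y).
Proof.
move=> t0 y1; have m0 := S_m_neq0 (ltW t0) y1; have s0 := sqn_gt0 m0.
have r0 := S_r_gt0 (ltW t0) y1; have h := Re_S_r_arg_gt t0 y1.
have At : 0 < a ^+ 2 + t by rewrite addr_gt0.
rewrite /S_B ReCD ReC1 ReCN ReCM ReC_toC ImC_toC mul0r subr0 ReCV -/(sqn _) subr_gt0.
rewrite mulrA ltr_pdivrMr// mul1r /S_m /sqn !ReCM !ImCM !ReC_toC !ImC_toC.
rewrite !mul0r !subr0 !addr0.
rewrite !ReCD !ImCD ReC1 ImC1 add0r.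
move: h; rewrite -[X in _ < ReC X]sqr_csqrt -/(S_r t y).
have -> : ReC (S_r t y ^+ 2) = ReC (S_r t y) ^+ 2 - ImC (S_r t y) ^+ 2 by rewrite !CE.
set X := ReC _ in r0 *; set Y := ImC _; set rho := _ / _ => h.
have hX : rho < X.
  have := sqr_ge0 Y; rewrite ltNge; move=> Y0; apply/negP => Xr.
  have : X ^+ 2 <= rho ^+ 2 by rewrite lerXn2r ?nnegrE ?(le_trans (ltW r0) Xr)// ltW.
  by lra.
have E : a ^+ 2 = (a ^+ 2 + t) / 2 * (1 + rho) by rewrite /rho; field; rewrite gt_eqF.
rewrite [ltLHS](_ : _ = (a ^+ 2 + t) / 2 * (1 + rho) *
  ((a ^+ 2 + t) / 2 * (1 + X))); last by rewrite -E.
have A0 : 0 < (a ^+ 2 + t) / 2 by rewrite divr_gt0.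
move: ((a ^+ 2 + t) / 2) A0 => A A0.
have -> : A * (1 + rho) * (A * (1 + X)) = A ^+ 2 * ((1 + rho) * (1 + X)) by ring.
have -> : (A * (1 + X)) ^+ 2 + (A * Y) ^+ 2 = A ^+ 2 * ((1 + X) ^+ 2 + Y ^+ 2) by ring.
rewrite ltr_pM2l ?exprn_gt0//.
have : (1 + rho) * (1 + X) < (1 + X) * (1 + X) by rewrite ltr_pM2r; lra.
by have := sqr_ge0 Y; rewrite !expr2; lra.
Qed.

Lemma Re_s_arg t y : 0 < t -> ReC y < 0 -> 0 < ReC (- (toC t * y)).
Proof. by move=> t0 y0; rewrite !CE mul0r subr0 oppr_gt0 pmulr_rlt0. Qed.

Lemma sqr_S_s t y : S_s t y ^+ 2 = toC t * y.
Proof. by rewrite /S_s exprMn sqrrN expr2 sqr_I sqr_csqrt mulN1r opprK. Qed.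

Lemma S_r_formula t y : 0 < t -> S_r t y ^+ 2 =
  1 + (4 * toC a ^+ 2 / toC t) / (1 + toC a ^+ 2 / toC t) ^+ 2 * y.
Proof.
move=> t0; have At : 0 < a ^+ 2 + t by rewrite addr_gt0.
have tn : toC t != 0 by rewrite toC_eq0 gt_eqF.
have An : toC a ^+ 2 + toC t != 0 by rewrite -toCX -toCD toC_eq0 gt_eqF.
have At' : t + a ^+ 2 != 0 by rewrite gt_eqF// addrC.
rewrite /S_r sqr_csqrt toC_S_kappa.
by field; rewrite ?tn ?An// addrC An.
Qed.

(** Rationalising with [(r - 1) (r + 1) = kappa y] cancels the pole of the bracket at [y = 0] and
    turns it into [1 - a^2 / m]. *)
Lemma S_b_formula t y : 0 < t -> -1 < ReC y -> y != 0 -> S_b t y ^+ 2 =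
  1 + (2 * y)^-1 + toC a ^+ 2 / (2 * toC t * y)
    - (2 * y)^-1 * (1 + toC a ^+ 2 / toC t) * S_r t y.
Proof.
move=> t0 y1 y0; have At : 0 < a ^+ 2 + t by rewrite addr_gt0.
have tn : toC t != 0 by rewrite toC_eq0 gt_eqF.
have An : toC a ^+ 2 + toC t != 0 by rewrite -toCX -toCD toC_eq0 gt_eqF.
have r0 := S_r_gt0 (ltW t0) y1.
have rn : 1 + S_r t y != 0 by rewrite neq0_Re// ReCD ReC1 gt_eqF// addr_gt0.
have two0 : (2 : C) != 0 by rewrite natC toC_eq0 pnatr_eq0.
rewrite /S_b sqr_csqrt /S_B /S_m toCM toCV toCD toCX -natC.
have rE : S_r t y - 1 =
    4 * toC a ^+ 2 * toC t / (toC a ^+ 2 + toC t) ^+ 2 * y / (1 + S_r t y).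
  have := sqr_csqrt (1 + toC (S_kappa t) * y); rewrite -/(S_r t y).
  rewrite toC_S_kappa => h.
  apply: (mulIf rn); rewrite divfK//.
  transitivity (S_r t y ^+ 2 - 1); first by ring.
  by rewrite h; ring.
transitivity (1 - (2 * y)^-1 * (1 + toC a ^+ 2 / toC t) * (S_r t y - 1)); last first.
  by field; rewrite ?tn ?y0.
by rewrite rE; field; rewrite ?tn ?y0 ?An ?rn.
Qed.

Lemma holo_S_r t y : 0 <= t -> -1 < ReC y -> holo (S_r t) y.
Proof.
move=> t0 y1; apply: derivable_csqrt_comp; last exact: Re_S_r_arg.
apply: holoD; first exact: holo_cst.
by apply: holoM; [exact: holo_cst|exact: holo_id].
Qed.

Lemma holo_S_b t y : 0 < t -> -1 < ReC y -> holo (S_b t) y.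
Proof.
move=> t0 y1; apply: derivable_csqrt_comp; last exact: Re_S_B.
apply: holoD; first exact: holo_cst.
apply: holoN; apply: holoM; first exact: holo_cst.
apply: holoV; first exact: (S_m_neq0 (ltW t0)).
apply: holoM; first exact: holo_cst.
by apply: holoD; [exact: holo_cst|exact: (holo_S_r (ltW t0))].
Qed.

Lemma holo_S_s t y : 0 < t -> ReC y < 0 -> holo (S_s t) y.
Proof.
move=> t0 y0; apply: holoM; first exact: holo_cst.
apply: derivable_csqrt_comp; last exact: Re_s_arg.
by apply: holoN; apply: holoM; [exact: holo_cst|exact: holo_id].
Qed.

Lemma holo_cvg (f : C -> C) (D : set C) z : holo f z ->
  f y @[y --> within D (nbhs z)] --> f z.
Proof.
move=> /derivable1_diffP /differentiable_continuous H.
apply: cvg_trans H; apply: cvg_app; exact: cvg_within.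
Qed.

Lemma S_r_cvg t (D : set C) : 0 < t ->
  S_r t y @[y --> within D (nbhs (0 : C))] --> (1 : C).
Proof.
move=> t0; have <- : S_r t 0 = 1 by rewrite /S_r mulr0 addr0 csqrt1.
by apply: holo_cvg; apply: holo_S_r; rewrite ?ReC0 ?ltrN10// ltW.
Qed.

Lemma S_b_cvg t (D : set C) : 0 < t ->
  exists2 l : R, 0 < l & S_b t y @[y --> within D (nbhs (0 : C))] --> toC l.
Proof.
move=> t0; have At : 0 < a ^+ 2 + t by rewrite addr_gt0.
(* At [y = 0] one has [r = 1] and [m = a^2 + t], hence [S_B = t / (a^2 + t)]. *)
exists (Num.sqrt (t / (a ^+ 2 + t))); first by rewrite sqrtr_gt0 divr_gt0.
have <- : S_b t 0 = toC (Num.sqrt (t / (a ^+ 2 + t))).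
  apply: csqrt_eq; first by rewrite ReC_toC sqrtr_gt0 divr_gt0.
  rewrite -toCX sqr_sqrtr ?divr_ge0 ?ltW// /S_B /S_m /S_r mulr0 addr0 csqrt1.
  rewrite -toC1 -toCD -toCM -toCV -toCM -toCN -toCD; congr toC.
  by field; rewrite gt_eqF.
by apply: holo_cvg; apply: holo_S_b; rewrite ?ReC0 ?ltrN10.
Qed.

End S_transform_branches.

(** * Values of the S-transforms, and the limit at time 0 *)

Section S_transform_values.
Variables (R : realType) (a : R) (w : R -> probability (measurableTypeR R) R).
Local Notation C := (Cplx R).
Local Notation G := cauchy_transform.
Implicit Types (z o u p y : C) (t : R).
Hypothesis a0 : 0 < a.
Hypothesis fw : free_process w.
Hypothesis w0E : forall A : set R, measurable A -> w 0 A = sym_bernoulli a A.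

Lemma Psi_lower t z : lower_cone z ->
  Psi (w t) z = z^-1 * G (w t) z^-1 - 1.
Proof. by case=> z0 _; apply: Psi_cauchy; rewrite lt_eqF. Qed.

Lemma Psi_half_disc t z : 0 <= t -> lower_cone z -> half_disc (Psi (w t) z).
Proof.
move=> t0 hz; rewrite Psi_lower//; apply: (cauchy_half_disc a0 fw w0E t0).
exact/upper_coneV.
Qed.

Lemma S_domain_half_disc y : S_domain w y -> half_disc y.
Proof.
move=> [t /= t0 [] [z hz <-]]; first exact: Psi_half_disc.
rewrite -(Psi_even a0 fw w0E t0 hz.1); apply: Psi_half_disc => //.
exact/lower_coneN.
Qed.

(** Reduces a statement about the partial inverse to one about all points [z] of the cone with
    [Psi mu z = y]. *)
Lemma S_transform_preimage (mu : probability (measurableTypeR R) R) (H : set C) y :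
  (Psi mu @` H) y ->
  exists z, [/\ H z, Psi mu z = y & S_transform mu H y = (1 + y) / y * z].
Proof.
move=> Hy; exists ('pinv_(fun=> 0) H (Psi mu) y); split => //.
  have := @surjpinv_image_sub _ _ (fun=> 0) H (Psi mu @` H) (Psi mu).
  by apply => //; exists y.
by rewrite pinvK// inE.
Qed.

Lemma S_value t z : 0 < t -> lower_cone z -> let y := Psi (w t) z in
  (1 + y) / y * z = (S_s t y)^-1 * S_b a t y.
Proof.
move=> t0 hz y; have hd : half_disc y by exact: (Psi_half_disc (ltW t0)).
have [y1 y2 yn] := half_discP hd.
have hp : upper_cone z^-1 by exact/upper_coneV.
have yE : y = z^-1 * G (w t) z^-1 - 1 by exact: Psi_lower.
have zn : z != 0 by case: hz => h _; rewrite neq0_Im// lt_eqF.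
have ul := cauchy_lower_cone a0 fw w0E (ltW t0) hp.
have [p0 _] := hp; have [u0 o0 Eu Ep] := subordination a0 fw w0E (ltW t0) p0.
have oc : upper_cone (z^-1 - toC t * G (w t) z^-1).
  apply: upper_coneD => //; apply/lower_coneN; rewrite opprK.
  move/lower_coneP: ul => ul; apply/lower_coneP.
  rewrite !CE !mul0r subr0 addr0 -mulrN normrM (gtr0_norm t0).
  by rewrite ltr_pM2l.
move: (z^-1 - _) o0 Eu Ep oc => o o0 Eu Ep oc.
move: (G (w t) z^-1) yE ul u0 Eu Ep => u yE ul u0 Eu Ep.
have [d1 d2 d3] := bern_neq0 a (lt0r_neq0 o0).
have on : o != 0 by rewrite neq0_Im ?gt_eqF.
pose c := (o ^+ 2 - toC a ^+ 2)^-1.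
have cn : c != 0 by rewrite invr_neq0.
have uE : u = o * c by rewrite -Eu.
have o2 : o ^+ 2 = toC a ^+ 2 + c^-1 by rewrite /c invrK; ring.
have u2 : u ^+ 2 = c * (1 + toC a ^+ 2 * c) by rewrite uE exprMn o2; field.
have y1E : 1 + y = (1 + toC a ^+ 2 * c) * (1 + toC t * c).
  rewrite yE -Ep Eu uE; transitivity (o ^+ 2 * c * (1 + toC t * c)); first by ring.
  by rewrite o2; field.
pose m := toC (a ^+ 2 + t) + toC t * toC a ^+ 2 * c.
have ym : y = c * m.
  by rewrite -[LHS](addKr 1) y1E /m toCD toCX; ring.
have At : 0 < a ^+ 2 + t by rewrite addr_gt0 ?exprn_gt0.
(* [c] is the product of the resolvents at [a] and [- a], so [|c|] is at most half of [spread o],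
   and [t / 2 * spread o < 1]. *)
have Re1 : 0 < 1 + t * ReC c.
  have tc : t * nrm c < 1.
    have sp := spread_lt o0 (_ : 0 < ImC (o + toC t * bern a o)).
    rewrite Ep in sp; have := sp p0; rewrite /spread => {}sp.
    have -> : c = (o - toC a)^-1 * (o + toC a)^-1 by rewrite /c subr_sqr invfM.
    rewrite nrmM; apply: le_lt_trans sp; rewrite -mulrA ler_pM2l//.
    rewrite -!nrm_sq; have := sqr_ge0 (nrm (o - toC a)^-1 - nrm (o + toC a)^-1).
    by rewrite !expr2; lra.
  have := nrm_Re c; rewrite ler_norml => /andP[h _]; nra.
(* Since [o] lies in the cone, [Re (o^2) = a^2 + Re c / |c|^2] is negative. Hence [Re c < 0] and
   [a^2 (Re c)^2 < - Re c]. *)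
have Re2 : 0 < 1 + a ^+ 2 * ReC c.
  have : ReC (o ^+ 2) < 0 by apply/cone_sqr; case: oc.
  rewrite o2 ReCD -toCX ReC_toC ReCV -/(sqn c) -ltrBrDl sub0r.
  rewrite ltr_pdivrMr ?sqn_gt0// => h.
  have : 0 <= (a ^+ 2 * ReC c) ^+ 2 + (a ^+ 2 * ImC c) ^+ 2 by rewrite addr_ge0 ?sqr_ge0.
  have a2 : 0 < a ^+ 2 by rewrite exprn_gt0.
  rewrite /sqn in h; have := sqr_ge0 (ImC c); rewrite !exprMn => h1 h2.
  rewrite ltNge; apply/negP => h3.
  have h4 : ReC c < 0 by nra.
  have : (1 + a ^+ 2 * ReC c) * ReC c < 0 by nra.
  by nra.
have An : toC a ^+ 2 + toC t != 0 by rewrite -toCX -toCD toC_eq0 gt_eqF.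
have two0 : (2 : C) != 0 by rewrite natC toC_eq0 pnatr_eq0.
have kE : toC (2 * t * a ^+ 2 / (a ^+ 2 + t)) =
    2 * toC t * toC a ^+ 2 / (toC a ^+ 2 + toC t).
  by rewrite toCM toCV [toC (2 * t * _)]toCM [toC (2 * t)]toCM -natC toCD !toCX.
(* The discriminant of the quadratic in [c] is a square. Multiplied by [a^2 + t], the real part of
   this root is [a^2 (1 + t Re c) + t (1 + a^2 Re c)], a sum of two positive terms. *)
have rE : S_r a t y = 1 + toC (2 * t * a ^+ 2 / (a ^+ 2 + t)) * c.
  apply: csqrt_eq.
    rewrite ReCD ReC1 ReCM ReC_toC ImC_toC mul0r subr0.
    rewrite -(pmulr_rgt0 _ At) mulrDr mulr1 mulrA.
    have -> : (a ^+ 2 + t) * (2 * t * a ^+ 2 / (a ^+ 2 + t)) = 2 * t * a ^+ 2.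
      by rewrite mulrC divfK// gt_eqF.
    have : 0 < a ^+ 2 * (1 + t * ReC c) by rewrite mulr_gt0 ?exprn_gt0.
    have : 0 < t * (1 + a ^+ 2 * ReC c) by rewrite mulr_gt0.
    lra.
  by rewrite toC_S_kappa ym /m kE toCD toCX; field.
have mE : S_m a t y = m.
  rewrite /S_m rE /m kE [toC ((_ + _) / 2)]toCM toCV -natC toCD toCX.
  by field; rewrite ?An ?two0.
have mn : m != 0 by rewrite -mE (S_m_neq0 a0 (ltW t0)).
have sy := sqr_S_s t y.
have tn : toC t != 0 by rewrite toC_eq0 gt_eqF.
have sn : S_s t y != 0.
  by apply: contraNneq (mulf_neq0 tn yn) => E; rewrite -sy E expr0n.
have bE : S_b a t y = S_s t y * (u / y).
  apply: csqrt_eq; last first.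
    rewrite exprMn sy exprMn u2 exprVn /S_B mE.
    transitivity (toC t * (1 + toC a ^+ 2 * c) / m).
      by rewrite ym; field; rewrite cn mn.
    have -> : toC t * (1 + toC a ^+ 2 * c) = m - toC a ^+ 2 by rewrite /m toCD toCX; ring.
    by rewrite -toCX; field.
  (* Sign of the root: with [sg = csqrt (- (t y))], the product [S_s * u / y] equals [t (i u) / sg].
     Both [i u] and [1 / sg] lie in the cone [|Im| < Re], so their product has positive real
     part. *)
  have sig := Re_s_arg t0 y2; have sign := csqrt_neq0 sig.
  have E (sg : C) : sg != 0 -> y = - sg ^+ 2 / toC t ->
      - mkC 0 1 * sg * (u / y) = toC t * ((mkC 0 1 * u) * sg^-1).
    by move=> sg0 ->; field; rewrite ?tn ?sg0.
  rewrite /S_s E//; last by rewrite sqr_csqrt; field.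
  rewrite ReCM ReC_toC ImC_toC mul0r subr0 mulr_gt0//; apply: Re_mul_gt0.
    move/lower_coneP: ul; rewrite ReCM ImCM ReC_mk ImC_mk !mul0r !mul1r sub0r add0r.
    by [].
  exact/right_coneV/csqrt_Im.
rewrite bE mulKf//.
have -> : 1 + y = z^-1 * u by rewrite yE; ring.
by field; rewrite yn zn.
Qed.

Lemma Psi0_bernoulli z : lower_cone z ->
  let p := z^-1 in let y := Psi (w 0) z in
  [/\ upper_cone p, p ^+ 2 - toC a ^+ 2 != 0, half_disc y &
      y = toC a ^+ 2 / (p ^+ 2 - toC a ^+ 2)].
Proof.
move=> hz p y; have hp : upper_cone p by exact/upper_coneV.
have [p0 _] := hp; have [_ _ d0] := bern_neq0 a (lt0r_neq0 p0).
split => //; first exact: Psi_half_disc.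
by rewrite /y Psi_lower// (cauchy_bernoulli a0 w0E) ?gt_eqF// -/p; field.
Qed.

(** With [p = 1/z] and [y = a^2 / (p^2 - a^2)], the ratio [(1 + y) / y] is [p^2 / a^2]. *)
Lemma S_value0 z : lower_cone z -> let y := Psi (w 0) z in
  (1 + y) / y * z = z^-1 / toC a ^+ 2.
Proof.
move=> hz /=; have [p0 d0 hd yE] := Psi0_bernoulli hz.
have zn : z != 0 by case: hz => h _; rewrite neq0_Im// lt_eqF.
have an : toC a != 0 by rewrite toC_eq0 gt_eqF.
have pn : z^-1 != 0 by rewrite invr_neq0.
have E (p : C) : p != 0 -> p ^+ 2 - toC a ^+ 2 != 0 ->
    (1 + toC a ^+ 2 / (p ^+ 2 - toC a ^+ 2)) / (toC a ^+ 2 / (p ^+ 2 - toC a ^+ 2)) * p^-1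
    = p / toC a ^+ 2.
  by move=> p1 p2; field; rewrite ?p1 ?p2 ?an ?addrNK.
by rewrite yE -[RHS]E// invrK.
Qed.

(** On the disc [(1 + y) / y] has negative real part, hence the factor [i]. Its sign selects the
    root in the upper half-plane, where [z^-1 / a] lies for [z] in the lower cone. *)
Definition S0_q y : C := mkC 0 1 * csqrt (- ((1 + y) / y)).

Lemma sqrt_branch_S0_q :
  sqrt_branch [set y : C | half_disc y] (fun y => (1 + y) / y) S0_q.
Proof.
move=> y /= hd; have [y1 y2 yn] := half_discP hd; have yr := half_disc_ratio hd.
split; last by rewrite /S0_q exprMn expr2 sqr_I sqr_csqrt mulN1r opprK.
apply: holoM; first exact: holo_cst.
apply: derivable_csqrt_comp; last by rewrite ReCN oppr_gt0.
apply: holoN; apply: holoM; last by apply: holoV => //; exact: holo_id.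
by apply: holoD; [exact: holo_cst|exact: holo_id].
Qed.

Lemma S0_q_value z : lower_cone z -> let y := Psi (w 0) z in
  (1 + y) / y * z = (toC a)^-1 * S0_q y.
Proof.
move=> hz y; rewrite S_value0//; have [[p0 _] d0 hd yE] := Psi0_bernoulli hz.
have zn : z != 0 by case: hz => h _; rewrite neq0_Im// lt_eqF.
have an : toC a != 0 by rewrite toC_eq0 gt_eqF.
have E : (1 + y) / y = z^-1 ^+ 2 / toC a ^+ 2.
  transitivity ((1 + y) / y * z / z); first by rewrite mulfK.
  by rewrite S_value0//; field; rewrite ?zn ?an.
have -> : S0_q y = z^-1 / toC a.
  rewrite /S0_q E.
  have -> : csqrt (- (z^-1 ^+ 2 / toC a ^+ 2)) = - mkC 0 1 * (z^-1 / toC a).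
    apply: csqrt_eq.
      rewrite -toCV mulrA ReCM ReC_toC ImC_toC mulr0 subr0 mulr_gt0 ?invr_gt0//.
      by rewrite ReCM ReCN ImCN ReC_mk ImC_mk oppr0 mul0r sub0r mulN1r opprK.
    by rewrite exprMn sqrrN [mkC 0 1 ^+ 2]expr2 sqr_I; field; rewrite ?zn ?an.
  by rewrite mulrA mulrN sqr_I opprK mul1r.
by field; rewrite ?zn ?an.
Qed.

Lemma S_m_cvg y : S_m a t y @[t --> (0 : R)^'+] --> toC a ^+ 2.
Proof.
have a2 : a ^+ 2 != 0 by rewrite gt_eqF// exprn_gt0.
have tid : t @[t --> (0 : R)^'+] --> (0 : R).
  by apply: cvg_at_right_filter; exact: cvg_id.
have tA : (a ^+ 2 + t) @[t --> (0 : R)^'+] --> a ^+ 2.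
  have H := cvgD (cvg_cst (a ^+ 2)) tid; rewrite addr0 in H; exact: H.
have kc : S_kappa a t @[t --> (0 : R)^'+] --> (0 : R).
  have a22 : a ^+ 2 * a ^+ 2 != 0 by rewrite mulf_neq0.
  have H := cvgM (cvgM (cvg_cst (4 * a ^+ 2)) tid) (cvgV a22 (cvgM tA tA)).
  by rewrite mulr0 mul0r in H; exact: H.
have rc : S_r a t y @[t --> (0 : R)^'+] --> (1 : C).
  rewrite -(csqrt1 R).
  have H : (1 + toC (S_kappa a t) * y) @[t --> (0 : R)^'+] --> (1 : C).
    have H := cvgD (cvg_cst (1 : C)) (cvgM (cvg_toC kc) (cvg_cst y)).
    rewrite toC0 mul0r addr0 in H; exact: H.
  by apply: (cvg_comp _ _ H); apply: csqrt_cont; rewrite ReC1 ltr01.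
have -> : toC a ^+ 2 = toC (a ^+ 2 / 2) * (1 + 1).
  by rewrite toCM toCV toCX -natC; field.
apply: cvgM.
  by apply: cvg_toC; apply: cvgM; [exact: tA|exact: cvg_cst].
by apply: cvgD; [exact: cvg_cst|exact: rc].
Qed.

(** Both [S_s] and [S_b] vanish like the square root of [t]. The factor is extracted by writing
    [S_B = t E(t)], where [E(t)] tends to [(1 + y) / a^2], of positive real part; the two square
    roots of [t] then cancel. *)
Lemma S_limit z : lower_cone z -> let y := Psi (w 0) z in
  (S_s t y)^-1 * S_b a t y @[t --> (0 : R)^'+] --> (1 + y) / y * z.
Proof.
move=> hz y; rewrite S_value0//; have [[p0 p1] d0 hd yE] := Psi0_bernoulli hz.
have zn : z != 0 by case: hz => h _; rewrite neq0_Im// lt_eqF.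
have an : toC a != 0 by rewrite toC_eq0 gt_eqF.
have [y1 y2 yn] := half_discP hd.
pose E t : C := toC a ^+ 2 * (1 + y) / (S_m a t y * (S_m a t y - toC t)).
have tid : t @[t --> (0 : R)^'+] --> (0 : R).
  by apply: cvg_at_right_filter; exact: cvg_id.
have Ec : E t @[t --> (0 : R)^'+] --> (1 + y) / toC a ^+ 2.
  have -> : (1 + y) / toC a ^+ 2 =
      toC a ^+ 2 * (1 + y) / (toC a ^+ 2 * (toC a ^+ 2 - toC 0)).
    by rewrite toC0; field.
  apply: cvgM; first exact: cvg_cst.
  apply: cvgV; first by rewrite toC0 subr0 mulf_neq0 ?expf_neq0.
  apply: cvgM; first exact: S_m_cvg.
  exact: (cvgB (S_m_cvg y) (cvg_toC tid)).
have E0 : 0 < ReC ((1 + y) / toC a ^+ 2).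
  rewrite -toCX -toCV ReCM ReC_toC ImC_toC mulr0 subr0 mulr_gt0 ?invr_gt0 ?exprn_gt0//.
  by rewrite ReCD ReC1 -ltrBlDl sub0r.
have y0 : 0 < ReC (- y) by rewrite ReCN oppr_gt0.
have BE t : 0 < t -> S_B a t y = toC t * E t.
  move=> t0; have mn := S_m_neq0 a0 (ltW t0) y1.
  have tn : toC t != 0 by rewrite toC_eq0 gt_eqF.
  have At : toC a ^+ 2 + toC t != 0.
    by rewrite -toCX -toCD toC_eq0 gt_eqF// addr_gt0 ?exprn_gt0.
  have two0 : (2 : C) != 0 by rewrite natC toC_eq0 pnatr_eq0.
  (* [S_m] is a root of [m^2 - (a^2 + t) m - a^2 t y = 0]; adding [a^2 t (1 + y)] to both sides
     factors the left-hand side. *)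
  have key : (S_m a t y - toC a ^+ 2) * (S_m a t y - toC t) =
      toC a ^+ 2 * toC t * (1 + y).
    have rE : S_r a t y ^+ 2 = 1 + toC (S_kappa a t) * y by exact: sqr_csqrt.
    rewrite toC_S_kappa in rE.
    have -> : S_m a t y = (toC a ^+ 2 + toC t) / 2 * (1 + S_r a t y).
      by rewrite /S_m toCM toCV toCD toCX -natC.
    transitivity ((toC a ^+ 2 + toC t) ^+ 2 / 4 * (S_r a t y ^+ 2 - 1)
        + toC a ^+ 2 * toC t); first by field.
    by rewrite rE; field; rewrite ?At.
  have mt : S_m a t y - toC t != 0.
    have at0 : toC a ^+ 2 * toC t != 0 by rewrite mulf_neq0 ?expf_neq0.
    apply/eqP => m0; move/eqP: key; rewrite m0 mulr0 eq_sym mulf_eq0 (negbTE at0) /=.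
    move=> /eqP y10.
    by move: E0; rewrite y10 mul0r ltxx.
  rewrite /S_B /E -toCX in key *.
  transitivity ((S_m a t y - toC (a ^+ 2)) / S_m a t y); first by field.
  apply: (mulIf mn); rewrite divfK//; apply: (mulIf mt); rewrite key.
  by field; rewrite ?mn ?mt.
have sy : csqrt (- y) != 0 by exact: csqrt_neq0.
have Fc : (mkC 0 1 * csqrt (E t) / csqrt (- y)) @[t --> (0 : R)^'+] -->
    mkC 0 1 * csqrt ((1 + y) / toC a ^+ 2) / csqrt (- y).
  apply: cvgM; last exact: cvg_cst.
  apply: cvgM; first exact: cvg_cst.
  exact: (cvg_comp _ _ Ec (csqrt_cont E0)).
have LE : mkC 0 1 * csqrt ((1 + y) / toC a ^+ 2) / csqrt (- y) = z^-1 / toC a ^+ 2.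
  (* The right-hand side is the principal root because [- i / z] and [csqrt (- y)] both lie in the
     cone [|Im| < Re]. *)
  have -> : csqrt ((1 + y) / toC a ^+ 2) =
      (- mkC 0 1 * z^-1 / toC a ^+ 2) * csqrt (- y).
    apply: csqrt_eq.
      apply: Re_mul_gt0; last exact: csqrt_Im.
      rewrite -toCX -toCV ReCM ImCM ReC_toC ImC_toC !mulr0 subr0 add0r.
      have ia : 0 < (a ^+ 2)^-1 by rewrite invr_gt0 exprn_gt0.
      rewrite normrM (gtr0_norm ia) ltr_pM2r//.
      have -> : ReC (- mkC 0 1 * z^-1) = ImC z^-1 by rewrite !CE; ring.
      have -> : ImC (- mkC 0 1 * z^-1) = - ReC z^-1 by rewrite !CE; ring.
      by rewrite normrN; move: p1; rewrite (gtr0_norm p0).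
    rewrite exprMn sqr_csqrt exprMn exprVn exprMn sqrrN [mkC 0 1 ^+ 2]expr2 sqr_I.
    rewrite -/y in yE.
    have pn : z^-1 != 0 by rewrite invr_neq0.
    move: (z^-1) pn d0 yE => p pn d0 yE; rewrite yE.
    by field; rewrite ?pn ?an ?d0 ?addrNK.
  by rewrite mulrA mulfK// !mulrA mulrN sqr_I opprK mul1r.
rewrite -LE; apply: cvg_trans Fc; apply: near_eq_cvg; near=> t.
have t0 : 0 < t by near: t; exact: nbhs_right_gt.
have Et : 0 < ReC (E t).
  have := Re_S_B a0 t0 y1; rewrite BE// ReCM ReC_toC ImC_toC mul0r subr0.
  by rewrite pmulr_rgt0.
have st : toC (Num.sqrt t) != 0 by rewrite toC_eq0 gt_eqF// sqrtr_gt0.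
rewrite /S_b BE// /S_s -mulrN !csqrtM_toC//.
have In : mkC 0 1 != 0 :> C by rewrite neq0_Im// ImC_mk oner_eq0.
have -> : (- mkC 0 1 * (toC (Num.sqrt t) * csqrt (- y)))^-1 =
   mkC 0 1 * (toC (Num.sqrt t) * csqrt (- y))^-1.
  rewrite invfM; congr (_ * _).
  by apply: (mulIf In); rewrite sqr_I invrN mulNr mulVf.
by field; rewrite ?st ?sy.
Unshelve. all: by end_near. Qed.

End S_transform_values.

Theorem proposition1p7 (R : realType) (a : R)
    (w : R -> probability (measurableTypeR R) R) :
  0 < a ->
  free_process w ->
  (forall A : set R, measurable A -> w 0 A = sym_bernoulli a A) ->
  (* R-transform *)
  (forall t : R, 0 <= t ->
     exists (U : set (Cplx R)) (r : Cplx R -> Cplx R),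
       [/\ nbhs (0 : Cplx R) U,
           sqrt_branch U (fun z => 1 + 4 * toC a ^+ 2 * z ^+ 2) r,
           r 0 = 1 &
           forall z, U z -> z != 0 ->
             R_transform (w t) z = 2^-1 * (2 * toC t * z ^+ 2 - 1 + r z)])
  /\
  (* S-transforms; F t is the right-hand side of the formula *)
  (exists r b s : R -> Cplx R -> Cplx R,
     let D := S_domain w in
     let F t z := (s t z)^-1 * b t z in
     [/\ forall t : R, 0 < t ->
           [/\ sqrt_branch D
                 (fun z => 1 + (4 * toC a ^+ 2 / toC t)
                             / (1 + toC a ^+ 2 / toC t) ^+ 2 * z) (r t)
               /\ (r t z @[z --> within D (nbhs (0 : Cplx R))] --> (1 : Cplx R)),
               sqrt_branch D
                 (fun z => 1 + (2 * z)^-1 + toC a ^+ 2 / (2 * toC t * z)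
                           - (2 * z)^-1 * (1 + toC a ^+ 2 / toC t) * r t z) (b t)
               /\ (exists2 l : R, 0 < l &
                     b t z @[z --> within D (nbhs (0 : Cplx R))] --> toC l),
               sqrt_branch D (fun z => toC t * z) (s t),
               forall z, (Psi (w t) @` lower_cone) z ->
                 S_transform (w t) lower_cone z = F t z &
               forall z, (Psi (w t) @` upper_cone) z ->
                 S_transform (w t) upper_cone z = - F t z],
         (forall z, (Psi (w 0) @` lower_cone) z ->
            F t z @[t --> (0 : R)^'+] --> S_transform (w 0) lower_cone z)
         /\ (forall z, (Psi (w 0) @` upper_cone) z ->
            - F t z @[t --> (0 : R)^'+] --> S_transform (w 0) upper_cone z) &
         exists2 q : Cplx R -> Cplx R,
           sqrt_branch D (fun z => (1 + z) / z) q &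
           (forall z, (Psi (w 0) @` lower_cone) z ->
              S_transform (w 0) lower_cone z = (toC a)^-1 * q z)
           /\ (forall z, (Psi (w 0) @` upper_cone) z ->
              S_transform (w 0) upper_cone z = - ((toC a)^-1 * q z))]).
Proof.
move=> a0 fw w0E; split; first exact: R_transform_formula.
have half y : S_domain w y -> half_disc y by exact: (S_domain_half_disc a0 fw w0E).
exists (S_r a), (S_b a), (@S_s R) => D F.
(* The upper cone is reduced to the lower one by [z -> - z]: [Psi] is unchanged and
   [(1 + y) / y * z] changes sign. *)
have upper t z : 0 <= t -> upper_cone z ->
    lower_cone (- z) /\ Psi (w t) (- z) = Psi (w t) z.
  by move=> t0 hz; split; [exact/lower_coneN|exact: (Psi_even a0 fw w0E t0 hz.1)].
have opp (z y : Cplx R) : (1 + y) / y * z = - ((1 + y) / y * - z).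
  by rewrite mulrN opprK.
split.
- move=> t t0; split.
  + split; last exact: S_r_cvg.
    move=> y /half /half_discP[y1 _ _].
    by split; [exact: (holo_S_r a0 (ltW t0))|exact: S_r_formula].
  + split; last exact: S_b_cvg.
    move=> y /half /half_discP[y1 _ y0].
    by split; [exact: holo_S_b|exact: S_b_formula].
  + move=> y /half /half_discP[_ y1 _].
    by split; [exact: holo_S_s|exact: sqr_S_s].
  + move=> y /S_transform_preimage[z [hz <- ->]].
    exact: (S_value a0 fw w0E).
  + move=> y /S_transform_preimage[z [hz <- ->]].
    have [hz' <-] := upper t z (ltW t0) hz.
    by rewrite opp (S_value a0 fw w0E).
- split.
  + move=> y /S_transform_preimage[z [hz <- ->]].
    exact: (S_limit a0 fw w0E).
  + move=> y /S_transform_preimage[z [hz <- ->]].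
    have [hz' <-] := upper 0 z (lexx 0) hz.
    by rewrite opp; apply: cvgN; exact: (S_limit a0 fw w0E).
- exists (@S0_q R).
    by move=> y /half hy; exact: sqrt_branch_S0_q.
  split=> y /S_transform_preimage[z [hz <- ->]].
    exact: (S0_q_value a0 fw w0E).
  have [hz' <-] := upper 0 z (lexx 0) hz.
  by rewrite opp (S0_q_value a0 fw w0E).
Qed.
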